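(* For every $W\in\mathrm{Gr}^{ad}$, the fractional right ideals $R_{b(W)}$ and $b(L_W)$ of $A_1$ are isomorphic as right $A_1$-modules. Equivalently, under the bijection $\alpha:\mathrm{Gr}^{ad}\to\mathcal R$, $W\mapsto[R_W]$, the action of the anti-automorphism $b$ of $A_1$ on $\mathcal R$ (given by $b\star[I]=[b(I)']$) corresponds to the bispectral involution $W\mapsto b(W)$.
   Context: $A_1=\mathbb C[z,\partial]$, $\partial=d/dz$, with quotient skew field $Q\supset\mathbb C(z)[\partial]$. $b$ is the anti-automorphism of $A_1$ (extended to $Q$) with $b(z)=\partial$, $b(\partial)=z$. For a left fractional ideal $J$, $J'=\{q\in Q: Jq\subset A_1\}$. $\mathcal R$ = isomorphism classes of nonzero right ideals. Adelic Grassmannian: a linear subspace $V\subset\mathbb C[z]$ is $\lambda$-primary if $(z-\lambda)^r\mathbb C[z]\subset V$ for some $r$, primary decomposable if a finite intersection $\bigcap_\lambda V_\lambda$ of $\lambda$-primary subspaces (distinct $\lambda$); $m_V=\prod(z-\lambda)^{k_\lambda}$, $k_\lambda=\dim\mathbb C[z]/V_\lambda$; $\mathrm{Gr}^{ad}=\{m_V^{-1}V\}$. With $\Gamma=\{e^{p(z)}\}$ acting on $\mathrm{Gr}^{ad}$ via $\gamma W=m_V^{-1}((\gamma\overline V)\cap\mathbb C[z])$ ($\overline V$ the closure in the space of entire functions), the stationary Baker function is $\psi_W(x,z)=e^{xz}\tilde\psi_W(x,z)$, where $\tilde\psi_W(x,\cdot)$ is the unique element of $e^{-xz}W$ of the form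 $1+O(z^{-1})$ (defined for all but finitely many $x$). The bispectral involution $b$ on $\mathrm{Gr}^{ad}$ is defined by $\psi_{b(W)}(x,z)=\psi_W(z,x)$ (it is known that such $b(W)\in\mathrm{Gr}^{ad}$ exists). $\mathcal D(U,V)=\{D\in\mathbb C(z)[\partial]: D.U\subset V\}$, $R_W=\mathcal D(\mathbb C[z],W)$, $L_W=\mathcal D(W,\mathbb C[z])$. *)

(* Defs.v *)
From Stdlib Require List.
From HB Require Import structures.
From mathcomp Require Import all_boot all_order all_algebra.
From mathcomp Require Import generic_quotient fraction.
From mathcomp Require Import complex.
From mathcomp Require Import reals.
From mathcomp.analysis Require Import sequences exp trigo.

Set Implicit Arguments.
Unset Strict Implicit.
Unset Printing Implicit Defensive.

Import Order.TTheory GRing.Theory Num.Theory.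
Local Open Scope ring_scope.
Notation "x %:F" := (@FracField.tofrac _ x) (format "x %:F") : ring_scope.

Section Bispectral.
Variable R : realType.
Local Notation C := R[i].

Definition ratfun := {fraction {poly C}}.

Definition cexp (w : C) : C :=
  Complex (expR (complex.Re w) * cos (complex.Im w))
          (expR (complex.Re w) * sin (complex.Im w)).
Definition cabs (w : C) : R := Num.sqrt (complex.Re w ^+ 2 + complex.Im w ^+ 2).

Definition subspace (V : {poly C} -> Prop) :=
  [/\ V 0, (forall p q, V p -> V q -> V (p + q)) & (forall (c : C) p, V p -> V (c *: p))].

Definition primary (lam : C) (U : {poly C} -> Prop) :=
  subspace U /\ exists r : nat, forall p, (('X - lam%:P) ^+ r %| p) -> U p.

Definition spans_mod (U : {poly C} -> Prop) (s : seq {poly C}) :=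
  forall p, exists c : seq C, U (p - \sum_(i < size s) c`_i *: s`_i).

Definition quot_dim (U : {poly C} -> Prop) (k : nat) :=
  (exists s, size s = k /\ spans_mod U s) /\ (forall s, spans_mod U s -> (k <= size s)%N).

(* A primary decomposition datum: a list of triples (lambda, V_lambda, k_lambda)
   with distinct lambda, V_lambda lambda-primary and k_lambda = dim C[z]/V_lambda. *)
Definition pdata := seq (C * ({poly C} -> Prop) * nat).

Definition Vof (d : pdata) (p : {poly C}) : Prop := forall t, List.In t d -> t.1.2 p.

Definition valid_pdata (d : pdata) :=
  uniq [seq t.1.1 | t <- d] /\
  (forall t, List.In t d -> primary t.1.1 t.1.2 /\ quot_dim t.1.2 t.2).

Definition mV (d : pdata) : {poly C} := \prod_(t <- d) ('X - t.1.1%:P) ^+ t.2.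

Definition inW (d : pdata) (f : ratfun) :=
  exists v, Vof d v /\ f = v%:F / (mV d)%:F.

(* closure in the space of entire functions (topology of uniform convergence
   on compacts): g is in the closure of V *)
Definition in_closure (V : {poly C} -> Prop) (g : C -> C) :=
  forall r eps : R, 0 < eps ->
    exists v, V v /\ forall w, cabs w <= r -> cabs (g w - v.[w]) < eps.

(* e^{-xz} W = m_V^{-1} ((e^{-xz} Vbar) cap C[z]) *)
Definition in_gammaW (d : pdata) (x : C) (f : ratfun) :=
  exists q : {poly C},
    in_closure (Vof d) (fun w => cexp (x * w) * q.[w]) /\ f = q%:F / (mV d)%:F.

(* h = 1 + O(z^{-1}) *)
Definition one_plus_O (h : ratfun) :=
  exists n dd : {poly C}, [/\ dd != 0, h = n%:F / dd%:F & (size (n - dd)%R < size dd)%N].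

Definition psit (d : pdata) (x : C) (h : ratfun) :=
  [/\ in_gammaW d x h, one_plus_O h &
      forall h', in_gammaW d x h' -> one_plus_O h' -> h' = h].

Definition fval (h : ratfun) (w c : C) :=
  exists n dd : {poly C}, [/\ dd.[w] != 0, h = n%:F / dd%:F & c = n.[w] / dd.[w]].

Definition baker (d : pdata) (x z c : C) :=
  exists h, psit d x h /\ exists c0, fval h z c0 /\ c = cexp (x * z) * c0.

Definition bispectral_dual (d d' : pdata) :=
  forall x z c c', baker d' x z c -> baker d z x c' -> c = c'.

Definition derivK (f : ratfun) : ratfun :=
  let r := repr f in
  ((\n_r)^`() * \d_r - \n_r * (\d_r)^`())%:F / (\d_r ^+ 2)%:F.

(* C(z)[d] : an element D = sum_i D_i(z) d^i is stored as the polynomial (in d)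
   with coefficients D_i in C(z), written on the left. *)
Definition opact (D : {poly ratfun}) (u : ratfun) : ratfun :=
  \sum_(i < size D) D`_i * iter i derivK u.

(* product in C(z)[d]:  (p d^i)(q d^j) = sum_k binom(i,k) p q^(k) d^(i+j-k) *)
Definition opmul (P Q : {poly ratfun}) : {poly ratfun} :=
  \sum_(i < size P) \sum_(j < size Q) \sum_(k < i.+1)
     (P`_i * ('C(i, k))%:R * iter k derivK Q`_j) *: 'X^(i + j - k).

(* A_1 = C[z, d]: a = sum_j a_j(z) d^j, coefficients a_j in C[z] on the left *)
Definition weyl := {poly {poly C}}.
Definition embA (a : weyl) : {poly ratfun} := map_poly (fun p : {poly C} => p%:F) a.

(* the anti-automorphism b of A_1: b(z^i d^j) = z^j d^i *)
Definition bA (a : weyl) : weyl :=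
  \poly_(i < \max_(j < size a) size (a`_j)%R) \poly_(j < size a) (a`_j)`_i.

Definition RW (d : pdata) (D : {poly ratfun}) :=
  forall p : {poly C}, inW d (opact D p%:F).
Definition LW (d : pdata) (D : {poly ratfun}) :=
  forall f, inW d f -> exists p : {poly C}, opact D f = p%:F.

End Bispectral.

(* Main.v *)
(* Write the Baker function of [W] as [e^{xz} Q(x,z) / (Delta(x) m_V(z))]. The space [V]
   is cut out by [k] independent functionals [L_i], each supported at one point [lam_i],
   and [e^{xz} g(x,z)] lies in the closure of [V] iff [\sum_a g_a(x) l_{i,a}(x) = 0] for
   all [i], where [e^{lam_i x} l_{i,a}(x) = L_i(z^a e^{xz})]. The solutions [g] over
   [C(x)] form a module under [tau = d/dx + z], free of rank one with generator [Q], of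
   degree [k] in [z]. An operator [E] lies in [R_{b(W)}] iff its symbol, multiplied by
   [m_{V'}], solves the system of [b(W)], that is, iff
   [E(z, d_z) e^{xz} = P(x, d_x) psi_{b(W)}(x,z)] for some operator [P] over [C(x)].
   Since [psi_{b(W)}(x,z) = psi_W(z,x)], this [P] acts in the spectral variable of
   [psi_W], and the existence of [E] with [P psi_W(z,x) = E e^{xz}] is equivalent to [P]
   mapping [W] into [C[z]]. The isomorphism is [E |-> P]: right multiplication of [E]
   by [z] and [d_z] becomes left multiplication of [P] by [d_x] and [x]. *)
Require Import Defs.
From HB Require Import structures.
From mathcomp Require Import all_boot all_order all_algebra.
From mathcomp Require Import generic_quotient fraction complex reals.
From mathcomp Require Import boolp ring lra.
From mathcomp Require Import classical_sets filter.
From mathcomp.analysis Require Import topology normedtype sequences exp trigo.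
Set Implicit Arguments.
Unset Strict Implicit.
Unset Printing Implicit Defensive.

Import Order.TTheory GRing.Theory Num.Theory.
Local Open Scope ring_scope.

(** * Differential operators over a differential field *)

(** Membership in [LK] is tested by integrality: [P] maps $W$ into polynomials iff [tw P] of a Baker
    numerator has coefficients in $C[x]$. The bispectral identity compares the numerators of
    $\psi_W(z,x)$ and $\psi_{b(W)}(x,z)$ only up to the factors $\Delta(z)$ and $m_{V'}(z)$. These
    are constants for $d/dx$, so they commute with [tw P], and they cancel in the integrality test
    because a nonzero polynomial in $z$ over $C$ is monic over $C[x]$ up to a scalar
    ([intg_of_kappaM]). The definition of the Baker function is analytic and pointwise. It becomes
    algebraic because a functional supported at a point is bounded by the supremum on a circle
    around it, hence passes to the closure; the identity, known for generic $x$ and $z$, is then one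
    of polynomials. Elements of [{poly K}] have two readings: functions to be multiplied by
    $e^{xz}$, with ['X] for $z$, and operators, with ['X] for $d$. In the second, [tau] is left
    multiplication by $d$, [delta] is right multiplication by the base variable, and [tw] is the
    product. The same [K] serves as $C(x)$ and as $C(z)$. *)

Section DiffField.
Variables (K : fieldType) (d : K -> K).
Hypothesis derD : forall a b, d (a + b) = d a + d b.
Hypothesis derM : forall a b, d (a * b) = d a * b + a * d b.
Implicit Types (a c : K) (u v g P Q : {poly K}).

Lemma der0 : d 0 = 0.
Proof. by apply: (addrI (d 0)); rewrite -derD !addr0. Qed.

Lemma der1 : d 1 = 0.
Proof. by apply: (addrI (d 1)); have := derM 1 1; rewrite !mulr1 !mul1r => <-; rewrite addr0. Qed.

Lemma derMn c n : d (c *+ n) = d c *+ n.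
Proof. by elim: n => [|n IH]; rewrite ?mulr0n ?der0 // !mulrS derD IH. Qed.

Lemma der_sum I (r : seq I) (Q : pred I) (F : I -> K) :
  d (\sum_(i <- r | Q i) F i) = \sum_(i <- r | Q i) d (F i).
Proof. exact: (big_morph d derD der0). Qed.

Definition derp u : {poly K} := \poly_(i < size u) d u`_i.

Lemma coef_derp u i : (derp u)`_i = d u`_i.
Proof.
by rewrite coef_poly; case: ltnP => // le_ui; rewrite nth_default // der0.
Qed.

(* [e^{xz} (tau u)] is the [x]-derivative of [e^{xz} u], where ['X] stands for [z]. *)
Definition tau u : {poly K} := derp u + 'X * u.

Lemma coef_tau u i : (tau u)`_i = d u`_i + (if i == 0 then 0 else u`_i.-1).
Proof. by rewrite coefD coef_derp coefXM. Qed.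

Lemma tauD u v : tau (u + v) = tau u + tau v.
Proof.
apply/polyP=> i; rewrite coefD !coef_tau !coefD derD addrACA.
by case: ifP; rewrite ?addr0.
Qed.

Lemma tau0 : tau 0 = 0.
Proof. by apply: (addrI (tau 0)); rewrite -tauD !addr0. Qed.

Lemma tauZ c u : tau (c *: u) = d c *: u + c *: tau u.
Proof.
apply/polyP=> i; rewrite !(coefD, coefZ, coef_tau) derM -addrA; congr (_ + _).
by rewrite mulrDr; case: ifP; rewrite ?mulr0.
Qed.

Lemma tau_sum I (r : seq I) (Q : pred I) (F : I -> {poly K}) :
  tau (\sum_(i <- r | Q i) F i) = \sum_(i <- r | Q i) tau (F i).
Proof. exact: (big_morph tau tauD tau0). Qed.

Lemma iter_tauD n u v : iter n tau (u + v) = iter n tau u + iter n tau v.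
Proof. by elim: n => //= n ->; rewrite tauD. Qed.

Lemma iter_tau0 n : iter n tau 0 = 0.
Proof. by elim: n => //= n ->; rewrite tau0. Qed.

Lemma iter_tau_sum n I (r : seq I) (Q : pred I) (F : I -> {poly K}) :
  iter n tau (\sum_(i <- r | Q i) F i) = \sum_(i <- r | Q i) iter n tau (F i).
Proof. exact: (big_morph _ (iter_tauD n) (iter_tau0 n)). Qed.

Lemma poly_sum_mono u : u = \sum_(i < size u) u`_i *: 'X^i.
Proof. by rewrite -poly_def coefK. Qed.

Lemma tauXn n : tau 'X^n = 'X^(n.+1).
Proof.
apply/polyP=> i; rewrite coef_tau !coefXn.
have -> : d (i == n)%:R = 0 by case: eqP; rewrite ?der0 ?der1.
by rewrite add0r; case: i.
Qed.

Lemma iter_tau1 n : iter n tau 1 = 'X^n.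
Proof. by elim: n => [|n IH]; rewrite ?expr0 //= IH tauXn. Qed.

Lemma derpM u v : derp (u * v) = derp u * v + u * derp v.
Proof.
apply/polyP=> i; rewrite coefD !coefM coef_derp coefM der_sum -big_split /=.
by apply: eq_bigr => j _; rewrite !coef_derp derM.
Qed.

Definition der_const v := derp v = 0.

Lemma der_constX : der_const 'X.
Proof.
by apply/polyP=> i; rewrite coef_derp coefX coef0; case: eqP; rewrite ?der0 ?der1.
Qed.

Lemma tau_mul_const u v : der_const v -> tau (u * v) = tau u * v.
Proof. by move=> v0; rewrite /tau derpM v0 mulr0 addr0 mulrDl mulrA. Qed.

Lemma tau_const v : der_const v -> tau v = 'X * v.
Proof. by move=> v0; rewrite /tau v0 add0r. Qed.

Lemma tau_coef0 u : (tau u)`_0 = d u`_0.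
Proof. by rewrite coef_tau eqxx addr0. Qed.

(** $e^{xz}$ times [delta x u] is the $z$-derivative of $e^{xz} u$. If ['X] stands for $d$ and
    [d x = 1], this is the operator product of [u] and [x], since $d^i x = x d^i + i d^{i-1}$. *)
Definition delta (x : K) u := u^`() + x *: u.

Lemma deltaD x u v : delta x (u + v) = delta x u + delta x v.
Proof. by rewrite /delta derivD scalerDr addrACA. Qed.

Lemma deltaZ x c u : delta x (c *: u) = c *: delta x u.
Proof. by rewrite /delta derivZ scalerDr !scalerA mulrC. Qed.

Lemma delta0 x : delta x 0 = 0.
Proof. by rewrite -(scale0r 0) deltaZ !scale0r. Qed.

Lemma delta_sum x I (r : seq I) (Q : pred I) (F : I -> {poly K}) :
  delta x (\sum_(i <- r | Q i) F i) = \sum_(i <- r | Q i) delta x (F i).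
Proof. exact: (big_morph _ (deltaD x) (delta0 x)). Qed.

Lemma delta_polyC x c : delta x c%:P = (x * c)%:P.
Proof. by rewrite /delta derivC add0r -mul_polyC -polyCM. Qed.

Lemma tau_delta x u : d x = 1 -> tau (delta x u) = delta x (tau u).
Proof.
move=> dx; rewrite /delta tauD tauZ dx scale1r {2}/tau derivD addrA [RHS]addrC addrC.
rewrite [_ *: _ + _]addrC [RHS]addrC; congr (_ + _).
rewrite derivM derivX mul1r /tau.
rewrite -addrA [_ + u]addrC; congr (_ + _).
by apply/polyP=> i; rewrite coef_derp !coef_deriv coef_derp derMn.
Qed.

Lemma size_tau u : u != 0 -> size (tau u) = (size u).+1.
Proof.
move=> u0; rewrite /tau addrC size_polyDl mulrC size_mulX //.
by rewrite ltnS size_poly.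
Qed.

Lemma lead_coef_tau u : lead_coef (tau u) = lead_coef u.
Proof.
have [-> | u0] := eqVneq u 0; first by rewrite tau0.
rewrite /tau addrC lead_coefDl; first by rewrite lead_coefM lead_coefX mul1r.
by rewrite mulrC size_mulX // ltnS size_poly.
Qed.

Lemma tau_neq0 u : u != 0 -> tau u != 0.
Proof. by move=> u0; rewrite -size_poly_eq0 size_tau. Qed.

Lemma size_iter_tau n u : u != 0 -> size (iter n tau u) = (n + size u)%N.
Proof.
move=> u0; suff: iter n tau u != 0 /\ size (iter n tau u) = (n + size u)%N by case.
elim: n => [//|n [n0 IH]] /=; split; first exact: tau_neq0.
by rewrite size_tau // IH.
Qed.

Lemma lead_coef_iter_tau n u : lead_coef (iter n tau u) = lead_coef u.
Proof. by elim: n => //= n IH; rewrite lead_coef_tau. Qed.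

(* The operator [P = \sum_j P`_j d^j] acting in the parameter on [e^{xz} u]. *)
Definition tw P u := \sum_(j < size P) P`_j *: iter j tau u.

Lemma tw_widen n P u : (size P <= n)%N -> tw P u = \sum_(j < n) P`_j *: iter j tau u.
Proof.
move=> le_Pn; rewrite /tw (big_ord_widen n (fun j => P`_j *: iter j tau u)) //.
rewrite big_mkcond; apply: eq_bigr => j _; case: ltnP => // le_Pj.
by rewrite nth_default // scale0r.
Qed.

Lemma twDl P Q u : tw (P + Q) u = tw P u + tw Q u.
Proof.
set n := maxn (size P) (size Q).
rewrite (@tw_widen n (P + Q)) ?size_polyD // (@tw_widen n P) ?leq_maxl //.
rewrite (@tw_widen n Q) ?leq_maxr // -big_split /=.
by apply: eq_bigr => j _; rewrite coefD scalerDl.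
Qed.

Lemma tw0l u : tw 0 u = 0.
Proof. by rewrite /tw size_poly0 big_ord0. Qed.

Lemma twZl c P u : tw (c *: P) u = c *: tw P u.
Proof.
rewrite (@tw_widen (size P)) ?size_scale_leq // /tw scaler_sumr.
by apply: eq_bigr => j _; rewrite coefZ scalerA.
Qed.

Lemma twNl P u : tw (- P) u = - tw P u.
Proof. by rewrite -scaleN1r twZl scaleN1r. Qed.

Lemma twBl P Q u : tw (P - Q) u = tw P u - tw Q u.
Proof. by rewrite twDl twNl. Qed.

Lemma twDr P u v : tw P (u + v) = tw P u + tw P v.
Proof.
by rewrite /tw -big_split /=; apply: eq_bigr => j _; rewrite iter_tauD scalerDr.
Qed.

Lemma tw0r P : tw P 0 = 0.
Proof. by rewrite /tw big1 // => j _; rewrite iter_tau0 scaler0. Qed.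

Lemma tw_sumr P I (r : seq I) (Q : pred I) (F : I -> {poly K}) :
  tw P (\sum_(i <- r | Q i) F i) = \sum_(i <- r | Q i) tw P (F i).
Proof. exact: (big_morph _ (twDr P) (tw0r P)). Qed.

Lemma tw_suml I (r : seq I) (Q : pred I) (F : I -> {poly K}) u :
  tw (\sum_(i <- r | Q i) F i) u = \sum_(i <- r | Q i) tw (F i) u.
Proof.
by apply: (big_morph (fun P => tw P u)) => [P1 P2|]; rewrite ?twDl ?tw0l.
Qed.

Lemma tw1r P : tw P 1 = P.
Proof.
by rewrite /tw [RHS]poly_sum_mono; apply: eq_bigr => j _; rewrite iter_tau1.
Qed.

Lemma tw_Xn n u : tw 'X^n u = iter n tau u.
Proof.
rewrite /tw size_polyXn big_ord_recr /= big1 ?add0r ?coefXn ?eqxx ?scale1r //.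
by move=> j _; rewrite coefXn (ltn_eqF (ltn_ord j)) scale0r.
Qed.

Lemma twC c u : tw c%:P u = c *: u.
Proof. by rewrite -[c%:P]mulr1 mul_polyC twZl -(expr0 'X) tw_Xn. Qed.

Lemma tw_tau P u : tw (tau P) u = tau (tw P u).
Proof.
rewrite (@tw_widen (size P).+1) /tw; last first.
  by have [-> | P0] := eqVneq P 0; rewrite ?tau0 ?size_poly0 // size_tau.
rewrite tau_sum; under [RHS]eq_bigr do rewrite tauZ -iterS.
under [LHS]eq_bigr do rewrite coef_tau scalerDl.
rewrite !big_split /=; congr (_ + _).
  by rewrite big_ord_recr /= nth_default // der0 scale0r addr0.
by rewrite big_ord_recl /= scale0r add0r.
Qed.

Lemma tw_iter_tau n P u : tw (iter n tau P) u = iter n tau (tw P u).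
Proof. by elim: n => //= n IH; rewrite tw_tau IH. Qed.

(** With ['X] read as $d$, [tw P Q] is the operator product, so this is associativity. *)
Lemma tw_tw P Q u : tw (tw P Q) u = tw P (tw Q u).
Proof.
rewrite {2}/tw tw_suml [RHS]/tw; apply: eq_bigr => j _.
by rewrite twZl tw_iter_tau.
Qed.

Lemma iter_tau_mul_const n u v : der_const v -> iter n tau (u * v) = iter n tau u * v.
Proof. by move=> v0; elim: n => //= n ->; rewrite tau_mul_const. Qed.

Lemma tw_mul_const P u v : der_const v -> tw P (u * v) = tw P u * v.
Proof.
move=> v0; rewrite /tw mulr_suml; apply: eq_bigr => j _.
by rewrite iter_tau_mul_const // scalerAl.
Qed.

Lemma tw_delta x P u : d x = 1 -> tw P (delta x u) = delta x (tw P u).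
Proof.
move=> dx; rewrite /tw delta_sum; apply: eq_bigr => j _; rewrite deltaZ; congr (_ *: _).
by elim: (nat_of_ord j) => //= n ->; rewrite tau_delta.
Qed.

Lemma tw_iter_delta x P n u : d x = 1 -> tw P (iter n (delta x) u) = iter n (delta x) (tw P u).
Proof. by move=> dx; elim: n => //= n IH; rewrite tw_delta // IH. Qed.

(** At $z = 0$ the twist by $e^{xz}$ disappears. Ordinary values of operators are read off from [tw]
    in this way. *)
Lemma tw_coef0 P u : (tw P u)`_0 = \sum_(i < size P) P`_i * iter i d u`_0.
Proof.
rewrite /tw coef_sum; apply: eq_bigr => i _; rewrite coefZ; congr (_ * _).
by elim: (nat_of_ord i) => //= n <-; rewrite tau_coef0.
Qed.

(** Euclidean division works because [tau] raises the degree by one and keeps the leading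
    coefficient. *)
Lemma tau_division g u : g != 0 -> exists P v, u = tw P g + v /\ (size v < size g)%N.
Proof.
move=> g0; have [n le_un] := ubnP (size u); elim: n u le_un => // n IH u le_un.
have [lt_ug | le_gu] := ltnP (size u) (size g); first by exists 0, u; rewrite tw0l add0r.
have u0 : u != 0 by rewrite -size_poly_gt0 (leq_trans _ le_gu) // size_poly_gt0.
pose j := (size u - size g)%N; pose c := lead_coef u / lead_coef g.
have lc : lead_coef g != 0 by rewrite lead_coef_eq0.
have c0 : c != 0 by rewrite mulf_neq0 ?invr_eq0 ?lead_coef_eq0.
have sj : size (c *: iter j tau g) = size u by rewrite size_scale // size_iter_tau // subnK.
have [|P [v [uE lt_vg]]] := IH (u - c *: iter j tau g).
  rewrite -ltnS (leq_trans _ le_un) // ltnS.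
  have le_su : (size (u - c *: iter j tau g)%R <= size u)%N.
    by rewrite (leq_trans (size_polyD _ _)) // size_polyN sj maxnn.
  rewrite ltn_neqAle le_su andbT; apply: contra_neqN u0 => /eqP.
  move=> E; have: lead_coef (u - c *: iter j tau g) = 0.
    rewrite lead_coefE E coefB -{2}sj -!lead_coefE lead_coefZ lead_coef_iter_tau.
    by rewrite /c divfK // subrr.
  by move/eqP; rewrite lead_coef_eq0 -size_poly_eq0 E size_poly_eq0 => /eqP.
exists (c *: 'X^j + P), v; split=> //.
by rewrite twDl twZl tw_Xn -addrA -uE addrC subrK.
Qed.

(** The sizes of [iter j tau g] increase strictly with [j], so the top term cannot cancel. *)
Lemma tw_eq0 P g : g != 0 -> tw P g = 0 -> P = 0.
Proof.
move=> g0; apply: contra_eq => P0; rewrite /tw.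
have: (0 < size P)%N by rewrite size_poly_gt0.
move: (lead_coefE P); case: (size P) => // n /= lP _.
have sg : (0 < size g)%N by rewrite size_poly_gt0.
have sn : size (P`_n *: iter n tau g) = (n + size g)%N.
  by rewrite size_scale ?size_iter_tau // -lP lead_coef_eq0.
rewrite big_ord_recr /= -size_poly_eq0 addrC size_polyDl sn.
  by rewrite -lt0n addn_gt0 sg orbT.
have [-> | n0] := posnP n; first by rewrite big_ord0 size_poly0.
apply: leq_ltn_trans (size_sum _ _ _) _.
apply: (@leq_ltn_trans (n.-1 + size g)); last by rewrite ltn_add2r prednK.
apply/bigmax_leqP => j _; apply: leq_trans (size_scale_leq _ _) _.
by rewrite size_iter_tau // leq_add2r -ltnS prednK.
Qed.

(* Leibniz rule [d^n c = \sum_k 'C(n, k) c^(k) d^(n - k)], with ['X] standing for [d]. *)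
Lemma iter_tau_mono n c j :
  iter n tau (c *: 'X^j) = \sum_(k < n.+1) (('C(n, k))%:R * iter k d c) *: 'X^(n + j - k).
Proof.
elim: n => [|n IH]; first by rewrite big_ord1 /= mul1r subn0.
rewrite iterS IH tau_sum.
have E (k : 'I_n.+1) : tau ((('C(n, k))%:R * iter k d c) *: 'X^(n + j - k)) =
    (('C(n, k))%:R * iter k.+1 d c) *: 'X^(n.+1 + j - k.+1) +
    (('C(n, k))%:R * iter k d c) *: 'X^(n.+1 + j - k).
  rewrite tauZ tauXn !mulr_natl derMn addSn subSS subSn //.
  by rewrite (leq_trans (leq_ord k)) // leq_addr.
rewrite (eq_bigr _ (fun k _ => E k)) big_split /= addrC.
rewrite [RHS]big_ord_recl /= bin0 mul1r.
under [X in _ = _ + X]eq_bigr do rewrite /bump /= add1n binS natrD mulrDl scalerDl.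
rewrite big_split /= addrA; congr (_ + _).
rewrite [in LHS]big_ord_recl /= bin0 mul1r; congr (_ + _).
rewrite [RHS]big_ord_recr /= bin_small // mul0r scale0r addr0.
by apply: eq_bigr => k _; rewrite /bump /= add1n.
Qed.

(** Identifies the explicit formula behind [opmul] with [tw]. *)
Lemma tw_opmul P (Q : {poly K}) :
  \sum_(i < size P) \sum_(j < size Q) \sum_(k < i.+1)
     (P`_i * ('C(i, k))%:R * iter k d Q`_j) *: 'X^(i + j - k) = tw P Q.
Proof.
rewrite /tw; apply: eq_bigr => i _.
rewrite [X in iter i tau X]poly_sum_mono iter_tau_sum scaler_sumr; apply: eq_bigr => j _.
rewrite iter_tau_mono scaler_sumr; apply: eq_bigr => k _.
by rewrite scalerA mulrA.
Qed.

End DiffField.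

(** * Common kernels of finitely many functionals *)

Section Pairing.
Variable K : comNzRingType.
Implicit Types (l : nat -> K) (u v : {poly K}).

Definition pairing l u := \sum_(a < size u) u`_a * l a.

Lemma pairing_widen n l u : (size u <= n)%N -> pairing l u = \sum_(a < n) u`_a * l a.
Proof.
move=> le_un; rewrite /pairing (big_ord_widen n (fun a => u`_a * l a)) //.
rewrite big_mkcond; apply: eq_bigr => a _; case: ltnP => // le_ua.
by rewrite nth_default // mul0r.
Qed.

Lemma pairingD l u v : pairing l (u + v) = pairing l u + pairing l v.
Proof.
set n := maxn (size u) (size v).
rewrite (@pairing_widen n l (u + v)) ?size_polyD // (@pairing_widen n l u) ?leq_maxl //.
rewrite (@pairing_widen n l v) ?leq_maxr // -big_split /=.
by apply: eq_bigr => a _; rewrite coefD mulrDl.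
Qed.

Lemma pairing0 l : pairing l 0 = 0.
Proof. by rewrite /pairing size_poly0 big_ord0. Qed.

Lemma pairingZ l c u : pairing l (c *: u) = c * pairing l u.
Proof.
rewrite (@pairing_widen (size u)) ?size_scale_leq // /pairing mulr_sumr.
by apply: eq_bigr => a _; rewrite coefZ mulrA.
Qed.

Lemma pairing_sum l I (r : seq I) (P : pred I) (F : I -> {poly K}) :
  pairing l (\sum_(i <- r | P i) F i) = \sum_(i <- r | P i) pairing l (F i).
Proof. exact: (big_morph _ (pairingD l) (pairing0 l)). Qed.

Lemma pairingXn l n : pairing l 'X^n = l n.
Proof.
rewrite /pairing size_polyXn big_ord_recr /= big1 ?add0r ?coefXn ?eqxx ?mul1r //.
by move=> j _; rewrite coefXn (ltn_eqF (ltn_ord j)) mul0r.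
Qed.

Definition annih k (l : nat -> nat -> K) u := forall i, (i < k)%N -> pairing (l i) u = 0.

Lemma annihZ k (l : nat -> nat -> K) c u : annih k l u -> annih k l (c *: u).
Proof. by move=> Mu i ik; rewrite pairingZ Mu // mulr0. Qed.

Lemma annihD k (l : nat -> nat -> K) u v : annih k l u -> annih k l v -> annih k l (u + v).
Proof. by move=> Mu Mv i ik; rewrite pairingD Mu // Mv // addr0. Qed.

End Pairing.

Section PairingField.
Variable K : fieldType.
Implicit Types (l : nat -> nat -> K) (u v : {poly K}).

Lemma annih_rVpoly n k l (v : 'rV[K]_n) :
  v *m \matrix_(a < n, i < k) l i a = 0 -> annih k l (rVpoly v).
Proof.
move=> vA i ik; have /matrixP/(_ 0 (Ordinal ik)) := vA.
rewrite !mxE => <-; rewrite (@pairing_widen _ n) ?size_poly //.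
by apply: eq_bigr => a _; rewrite coef_rVpoly_ord mxE.
Qed.

Lemma exists_annih k l : exists u, [/\ u != 0, (size u <= k.+1)%N & annih k l u].
Proof.
pose A := \matrix_(a < k.+1, i < k) l i a.
have : kermx A != 0.
  by rewrite -mxrank_eq0 mxrank_ker subn_eq0 -ltnNge ltnS rank_leq_col.
case/rowV0Pn => v; rewrite sub_kermx => /eqP vA v0.
exists (rVpoly v); split; [| exact: size_poly | exact: annih_rVpoly].
by apply: contra_neq v0 => E; rewrite -[v]rVpolyK E linear0.
Qed.

Lemma annih_det_eq0 k l u :
  \det (\matrix_(a < k, i < k) l i a) != 0 -> annih k l u -> (size u <= k)%N -> u = 0.
Proof.
move=> det0 Mu le_uk; rewrite -[u](@poly_rV_K _ k) //.
suff -> : poly_rV u = 0 :> 'rV_k by rewrite linear0.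
apply/eqP; apply: contraNT det0 => v0; apply/det0P; exists (poly_rV u) => //.
apply/rowP => i; rewrite !mxE -[RHS](Mu i (ltn_ord i)) (@pairing_widen _ k) //.
by apply: eq_bigr => a _; rewrite !mxE.
Qed.

Lemma det_annih_neq0 k l :
  (forall u, annih k l u -> (size u <= k)%N -> u = 0) ->
  \det (\matrix_(a < k, i < k) l i a) != 0.
Proof.
move=> H; apply/negP => /det0P [v v0 vA].
by case/negP: v0; rewrite -[v]rVpolyK (H _ (annih_rVpoly vA)) ?size_poly ?linear0.
Qed.

End PairingField.

Section PairingDer.
Variables (K : fieldType) (d : K -> K).
Hypothesis derD : forall a b, d (a + b) = d a + d b.
Hypothesis derM : forall a b, d (a * b) = d a * b + a * d b.
Implicit Types u v g : {poly K}.

(** The recurrence is the one satisfied by $l_a = e^{-\lambda x} L(z^a e^{xz})$; multiplied by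
    $e^{\lambda x}$, the conclusion says that $L$ commutes with $d/dx$. *)
Lemma pairing_tau (l : nat -> K) lam u :
  (forall a, l a.+1 = d (l a) + lam * l a) ->
  pairing l (tau d u) = d (pairing l u) + lam * pairing l u.
Proof.
move=> lS; rewrite (@pairing_widen _ (size u).+1 l (tau d u)); last first.
  by have [-> | u0] := eqVneq u 0; rewrite ?tau0 ?size_poly0 // size_tau.
under eq_bigr do rewrite (coef_tau derD) mulrDl.
rewrite big_split big_ord_recr /= nth_default // (der0 derD) mul0r addr0.
rewrite [in X in _ + X]big_ord_recl /= mul0r add0r.
rewrite /pairing (der_sum derD) mulr_sumr -!big_split /=; apply: eq_bigr => a _.
by rewrite lS derM mulrDr addrA mulrCA.
Qed.

Variables (k : nat) (l : nat -> nat -> K) (lam : nat -> K).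
Hypothesis lS : forall i a, l i a.+1 = d (l i a) + lam i * l i a.

Lemma annih_tau u : annih k l u -> annih k l (tau d u).
Proof. by move=> Mu i ik; rewrite (pairing_tau _ (lS i)) Mu // (der0 derD) mulr0 addr0. Qed.

Lemma annih_tw P u : annih k l u -> annih k l (tw d P u).
Proof.
move=> Mu i ik; rewrite /tw pairing_sum big1 // => j _; rewrite pairingZ.
have -> : pairing (l i) (iter j (tau d) u) = 0; last by rewrite mulr0.
by move: i ik; elim: (nat_of_ord j) => //= n IH; apply: annih_tau.
Qed.

Hypothesis l_free : forall c : nat -> K,
  (forall a, \sum_(i < k) c i * l i a = 0) -> forall i, (i < k)%N -> c i = 0.

(* If [g] in [M] had size [n + 1 <= k], a combination of the [k] functionals killing
   [1, ..., X^(n-1)] would kill [K[d] g] and, by division by [g], everything. *)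
Lemma annih_small_eq0 g : annih k l g -> (size g <= k)%N -> g = 0.
Proof.
move=> Mg le_gk; apply/eqP/negPn/negP => g0.
have sg : size g = (size g).-1.+1 by rewrite prednK // size_poly_gt0.
set n := (size g).-1 in sg.
pose A := \matrix_(i < k, a < n) l i a.
have : kermx A != 0.
  rewrite -mxrank_eq0 mxrank_ker subn_eq0 -ltnNge (leq_ltn_trans (rank_leq_col A)) //.
  by rewrite -sg.
case/rowV0Pn => v; rewrite sub_kermx => /eqP vA v0.
pose c i := if insub i is Some j then v 0 j else 0.
have cE (i : 'I_k) : c i = v 0 i by rewrite /c valK.
have c0 i : (i < k)%N -> c i = 0.
  apply: l_free => {i} a.
  have [P [w [XE lt_w]]] := tau_division derD 'X^a g0.
  have le_wn : (size w <= n)%N by rewrite -ltnS -sg.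
  transitivity (\sum_(i < k) c i * pairing (l i) w).
    apply: eq_bigr => i _; congr (_ * _); rewrite -pairingXn XE pairingD.
    by rewrite (annih_tw P Mg) // add0r.
  under eq_bigr do rewrite (pairing_widen _ le_wn) mulr_sumr.
  rewrite exchange_big big1 //= => b _.
  have /rowP/(_ b) := vA; rewrite !mxE => vb.
  transitivity (w`_b * \sum_j v 0 j * A j b); last by rewrite vb mulr0.
  rewrite mulr_sumr; apply: eq_bigr => i _.
  by rewrite mxE cE mulrCA.
case/negP: v0; apply/eqP/rowP => i; rewrite mxE -cE c0 //.
Qed.

(** The remainder of [u] modulo [g] is again a solution, and too small to be nonzero. *)
Lemma annih_generator g u :
  annih k l g -> size g = k.+1 -> annih k l u -> exists P, u = tw d P g.
Proof.
move=> Mg sg Mu; have g0 : g != 0 by rewrite -size_poly_gt0 sg.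
have [P [v [uE lt_v]]] := tau_division derD u g0; exists P.
suff v0 : v = 0 by rewrite uE v0 addr0.
apply: annih_small_eq0; last by rewrite -ltnS -sg.
have -> : v = u + (-1) *: tw d P g by rewrite uE scaleN1r addrC addKr.
by apply: annihD => //; apply/annihZ/annih_tw.
Qed.

End PairingDer.

(** * Polynomials in two variables and integrality over C[x] *)

Section Bivariate.
Variable C : comNzRingType.
Implicit Types (g h : {poly {poly C}}) (p : {poly C}).

(** The inner variable is $x$ and the outer one $z$. [tauC] and [deltaC] are [tau] and [delta]
    before embedding into [{poly K}], and exchanging the variables exchanges them. *)
Definition tauC g := map_poly (@deriv C) g + 'X * g.
Definition deltaC g := g^`() + 'X *: g.
Definition eval_x (c : C) g : {poly C} := map_poly (horner_eval c) g.

Lemma swapXY_deltaC g : swapXY (deltaC g) = tauC (swapXY g).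
Proof.
rewrite /deltaC /tauC linearD /= -mul_polyC rmorphM /= swapXY_polyC map_polyX; congr (_ + _).
apply/polyP=> i; apply/polyP=> j; rewrite coef_swapXY !coef_deriv coef_map /= coef_deriv.
by rewrite coef_swapXY coefMn.
Qed.

Lemma swapXY_iter_deltaC n g : swapXY (iter n deltaC g) = iter n tauC (swapXY g).
Proof. by elim: n => //= n IH; rewrite swapXY_deltaC IH. Qed.

Lemma coef0_swapXY g : (swapXY g)`_0 = eval_x 0 g.
Proof.
apply/polyP=> i; rewrite coef_swapXY /eval_x coef_map /= /horner_eval.
by rewrite horner_coef0.
Qed.

End Bivariate.

Section Extension.
Variables (C : numFieldType) (K : fieldType) (e : {rmorphism {poly C} -> K}) (d : K -> K).
Hypothesis derD : forall a b, d (a + b) = d a + d b.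
Hypothesis derM : forall a b, d (a * b) = d a * b + a * d b.
Hypothesis d_e : forall p, d (e p) = e p^`().
Hypothesis e_inj : injective e.
Hypothesis e_frac : forall f, exists a b : {poly C}, b != 0 /\ f = e a / e b.
Implicit Types (f : {poly K}) (g h : {poly {poly C}}) (p : {poly C}).

Definition emb g : {poly K} := map_poly e g.
Definition intg f := exists h, f = emb h.

Lemma embD g h : emb (g + h) = emb g + emb h.
Proof. exact: rmorphD. Qed.

Lemma emb_sum I (r : seq I) (P : pred I) (F : I -> {poly {poly C}}) :
  emb (\sum_(i <- r | P i) F i) = \sum_(i <- r | P i) emb (F i).
Proof. exact: rmorph_sum. Qed.

Lemma embM g h : emb (g * h) = emb g * emb h.
Proof. exact: rmorphM. Qed.

Lemma embX : emb 'X = 'X.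
Proof. exact: map_polyX. Qed.

Lemma embC p : emb p%:P = (e p)%:P.
Proof. exact: map_polyC. Qed.

Lemma e_eq0 p : (e p == 0) = (p == 0).
Proof. by rewrite -(rmorph0 e) (inj_eq e_inj). Qed.

Lemma emb_inj : injective emb.
Proof. exact: map_inj_poly (rmorph0 e). Qed.

Lemma size_emb g : size (emb g) = size g.
Proof. by rewrite size_map_inj_poly // rmorph0. Qed.

Lemma emb_swapZ p g : emb (p *: g) = e p *: emb g.
Proof. by rewrite /emb map_polyZ. Qed.

Lemma tau_emb g : tau d (emb g) = emb (tauC g).
Proof.
apply/polyP=> i; rewrite (coef_tau derD) !coef_map /= coefD coef_map /= coefXM rmorphD d_e.
by congr (_ + _); case: ifP; rewrite ?rmorph0 // coef_map.
Qed.

Lemma delta_emb g : delta (e 'X) (emb g) = emb (deltaC g).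
Proof. by rewrite /delta /deltaC /emb rmorphD /= map_polyZ deriv_map. Qed.

Lemma iter_delta_emb n g : iter n (delta (e 'X)) (emb g) = emb (iter n (@deltaC C) g).
Proof. by elim: n => //= n ->; rewrite delta_emb. Qed.

Lemma d_eX : d (e 'X) = 1.
Proof. by rewrite d_e derivX rmorph1. Qed.

(** This is $p(z)$, in contrast to $p(x)$, which is [emb p%:P]; it is constant for [d]. *)
Definition kappa p := emb (map_poly polyC p).

Lemma kappa_const p : der_const d (kappa p).
Proof.
apply/polyP=> i; rewrite (coef_derp derD) coef0 !coef_map /= d_e derivC.
by rewrite rmorph0.
Qed.

Lemma intgM f1 f2 : intg f1 -> intg f2 -> intg (f1 * f2).
Proof. by case=> h1 -> [h2 ->]; exists (h1 * h2); rewrite /emb rmorphM. Qed.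

Lemma intg_sum I (r : seq I) (P : pred I) (F : I -> {poly K}) :
  (forall i, P i -> intg (F i)) -> intg (\sum_(i <- r | P i) F i).
Proof.
move=> H; elim/big_ind: _ => //; first by exists 0; rewrite /emb rmorph0.
by move=> _ _ [h1 ->] [h2 ->]; exists (h1 + h2); rewrite /emb rmorphD.
Qed.

(** After scaling, [p] is monic in $z$, so one can divide by it with remainder over $C[x]$. The
    remainder is a multiple of [p] over [K] of smaller size, hence zero. *)
Lemma intg_of_kappaM p f : p != 0 -> intg (kappa p * f) -> intg f.
Proof.
move=> p0 [h]; have lp0 : lead_coef p != 0 by rewrite lead_coef_eq0.
pose p1 := (lead_coef p)^-1 *: p; pose P := map_poly polyC p1 : {poly {poly C}}.
have Pmon : P \is monic.
  rewrite map_monic /p1; apply/monicP; rewrite lead_coefZ mulVf //.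
move=> E; have {}E : emb P * f = emb ((lead_coef p)^-1%:P *: h).
  rewrite emb_swapZ -E /P /p1 map_polyZ /= emb_swapZ.
  by rewrite -scalerAl.
move: ((lead_coef p)^-1%:P *: h) E => {}h E.
have hE := Pdiv.RingMonic.rdivp_eq Pmon h.
exists (Pdiv.Ring.rdivp h P); apply/eqP; rewrite -subr_eq0; apply/negPn/negP => f0.
have lt_r : (size (Pdiv.Ring.rmodp h P) < size P)%N.
  by rewrite Pdiv.Ring.ltn_rmodpN0 // monic_neq0.
have : emb P * (f - emb (Pdiv.Ring.rdivp h P)) = emb (Pdiv.Ring.rmodp h P).
  by rewrite mulrBr E {1}hE /emb rmorphD rmorphM /= mulrC addrC addKr.
move/(congr1 (fun u : {poly K} => size u)); rewrite size_emb => sE.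
move: lt_r; rewrite -sE size_mul ?size_emb //; last first.
  by rewrite -size_poly_eq0 size_emb size_poly_eq0 monic_neq0.
rewrite -size_poly_gt0 in f0; rewrite -(prednK f0) addnS /= ltnNge.
by rewrite leq_addr.
Qed.

Lemma clear_denominators f : exists a h, a != 0 /\ e a *: f = emb h.
Proof.
elim/poly_ind: f => [|f c [a [h [a0 E]]]].
  by exists 1, 0; rewrite oner_eq0 /emb rmorph0 scaler0.
have [n [b [b0 cE]]] := e_frac c.
exists (b * a), ((b *: h) * 'X + (a * n)%:P); split; first by rewrite mulf_neq0.
rewrite embD embM embX embC emb_swapZ -E scalerDr scalerA -rmorphM scalerAl.
congr (_ + _); rewrite -mul_polyC -polyCM; congr _%:P.
by rewrite cE mulrC !rmorphM mulrA divfK ?e_eq0 // mulrC.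
Qed.

Lemma intg_coef f : (forall i, exists p, f`_i = e p) -> intg f.
Proof.
elim/poly_ind: f => [_|f c IH H]; first by exists 0; rewrite /emb rmorph0.
have [|h fE] := IH.
  by move=> i; have [p E] := H i.+1; exists p; rewrite -E coefD coefMX coefC addr0.
have [p] := H 0%N; rewrite coefD coefMX coefC add0r => cE.
by exists (h * 'X + p%:P); rewrite fE cE /emb rmorphD rmorphM /= map_polyX map_polyC.
Qed.

(** For an operator [f], the hypothesis says that it maps every $x^n$ to a polynomial. Since
    coefficient $i$ of [delta f] is $(i+1) f_{i+1} + x f_i$, the coefficients turn out polynomial
    one after the other. *)
Lemma intg_of_deltas f :
  (forall n, exists p, (iter n (delta (e 'X)) f)`_0 = e p) -> intg f.
Proof.
move=> H; apply: intg_coef => i; elim: i f H => [|i IH] f H; first exact: (H 0%N).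
have [p] : exists p, (delta (e 'X) f)`_i = e p.
  by apply: IH => n; rewrite -iterSr; apply: H.
have [q fE] := IH f H; rewrite coefD coef_deriv coefZ fE => E.
exists ((i.+1%:R)^-1 *: (p - 'X * q)).
have n0 : (i.+1%:R : {poly C}) != 0 by rewrite -polyC_natr polyC_eq0 pnatr_eq0.
have : e (i.+1%:R) != 0 by rewrite e_eq0.
move/mulfI; apply; rewrite -rmorphM -scalerAr scalerAl -polyC_natr.
rewrite -mul_polyC -polyCM mulVf ?pnatr_eq0 // mul1r rmorphB rmorphM -E addrK.
by rewrite polyC_natr rmorph_nat mulr_natl.
Qed.

End Extension.

(** * Functionals defining a primary decomposable space *)

Section DualData.
Variable C : numFieldType.
Implicit Types (p q v : {poly C}) (g G : {poly {poly C}}).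

(* [V] is the common kernel of [k] independent functionals, the [i]-th one depending
   only on the Taylor expansion at [node i] up to order [mult i]. *)
Record dual_data (V : {poly C} -> Prop) (k : nat) := DualData {
  fnl : nat -> {poly C} -> C;
  node : nat -> C;
  mult : nat -> nat;
  dvec : nat -> {poly C};
  fnl_linear : forall i c p q, fnl i (c *: p + q) = c * fnl i p + fnl i q;
  fnl_kill : forall i p, fnl i (('X - (node i)%:P) ^+ mult i * p) = 0;
  fnl_dual : forall i j, (i < k)%N -> (j < k)%N -> fnl i (dvec j) = (i == j)%:R;
  fnl_mem : forall p, V p <-> forall i, (i < k)%N -> fnl i p = 0 }.

Variables (V : {poly C} -> Prop) (k : nat) (D : dual_data V k).
Local Notation L := (fnl D).
Local Notation nd := (node D).
Local Notation mu := (mult D).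

Lemma fnlD i p q : L i (p + q) = L i p + L i q.
Proof. by rewrite -[p]scale1r fnl_linear mul1r scale1r. Qed.

Lemma fnl0 i : L i 0 = 0.
Proof. by apply: (addrI (L i 0)); rewrite -fnlD !addr0. Qed.

Lemma fnlZ i c p : L i (c *: p) = c * L i p.
Proof. by rewrite -[c *: p]addr0 fnl_linear fnl0 addr0. Qed.

Lemma fnl_sum i I (r : seq I) (P : pred I) (F : I -> {poly C}) :
  L i (\sum_(j <- r | P j) F j) = \sum_(j <- r | P j) L i (F j).
Proof. exact: (big_morph _ (fnlD i) (fnl0 i)). Qed.

Lemma fnl_kill_ge i n p : (mu i <= n)%N -> L i (('X - (nd i)%:P) ^+ n * p) = 0.
Proof. by move=> le_n; rewrite -(subnKC le_n) exprD -mulrA fnl_kill. Qed.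

(** $e^{-\lambda x} L_i(z^a e^{xz})$ for $\lambda$ the node, with $e^{x(z-\lambda)}$ expanded. It is
    a polynomial in $x$ because $L_i$ kills high powers of $z-\lambda$. *)
Definition moment i a : {poly C} :=
  \poly_(j < mu i) (L i (('X - (nd i)%:P) ^+ j * 'X^a) / j`!%:R).

Lemma coef_moment i a j :
  (moment i a)`_j = L i (('X - (nd i)%:P) ^+ j * 'X^a) / j`!%:R.
Proof.
by rewrite coef_poly; case: ltnP => // le_j; rewrite fnl_kill_ge // mul0r.
Qed.

Lemma momentS i a : moment i a.+1 = (moment i a)^`() + (nd i)%:P * moment i a.
Proof.
apply/polyP=> j; rewrite coefD coef_deriv mul_polyC coefZ !coef_moment.
have -> : ('X - (nd i)%:P) ^+ j * 'X^(a.+1) =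
    ('X - (nd i)%:P) ^+ j.+1 * 'X^a + nd i *: (('X - (nd i)%:P) ^+ j * 'X^a).
  have -> : 'X^(a.+1) = ('X - (nd i)%:P) * 'X^a + nd i *: 'X^a.
    by rewrite -mul_polyC -mulrDl subrK exprS.
  by rewrite mulrDr mulrA -exprSr scalerAr.
rewrite fnlD fnlZ mulrDl mulrA; congr (_ + _).
rewrite -[RHS]mulr_natr -[RHS]mulrA; congr (_ * _).
by rewrite factS natrM invfM mulrAC mulVf ?pnatr_eq0 // mul1r.
Qed.

Lemma moment_at0 i a : (moment i a).[0] = L i 'X^a.
Proof. by rewrite horner_coef0 coef_moment expr0 mul1r fact0 divr1. Qed.

(* The Taylor polynomial of [e^{x(z - node i)}]. *)
Definition texp i (x : C) : {poly C} :=
  \sum_(j < mu i) (x ^+ j / j`!%:R) *: ('X - (nd i)%:P) ^+ j.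

Lemma moment_at i a x : (moment i a).[x] = L i (texp i x * 'X^a).
Proof.
rewrite horner_poly mulr_suml fnl_sum; apply: eq_bigr => j _.
by rewrite -scalerAl fnlZ mulrC mulrA mulrAC.
Qed.

Lemma pairing_moment_at i x q :
  pairing (fun a => (moment i a).[x]) q = L i (texp i x * q).
Proof.
rewrite {2}(poly_sum_mono q) mulr_sumr fnl_sum; apply: eq_bigr => a _.
by rewrite -scalerAr fnlZ moment_at.
Qed.

Lemma pairing_horner (l : nat -> {poly C}) x g :
  (pairing l g).[x] = pairing (fun a => (l a).[x]) (eval_x x g).
Proof.
rewrite (@pairing_widen _ (size g) _ (eval_x x g)) ?size_poly // /pairing horner_sum.
by apply: eq_bigr => a _; rewrite hornerM coef_map.
Qed.

Lemma pairing_moment0 i g : (pairing (moment i) g).[0] = L i (eval_x 0 g).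
Proof.
rewrite pairing_horner {2}(poly_sum_mono (eval_x 0 g)) fnl_sum; apply: eq_bigr => a _.
by rewrite fnlZ moment_at0.
Qed.

Lemma fnl_free (c : nat -> C) :
  (forall a, \sum_(i < k) c i * L i 'X^a = 0) -> forall i, (i < k)%N -> c i = 0.
Proof.
move=> H i ik; have {}H p : \sum_(i < k) c i * L i p = 0.
  rewrite (poly_sum_mono p); under eq_bigr do rewrite fnl_sum mulr_sumr.
  rewrite exchange_big big1 //= => a _; under eq_bigr do rewrite fnlZ mulrCA.
  by rewrite -mulr_sumr H mulr0.
have := H (dvec D i); rewrite (bigD1 (Ordinal ik)) //= fnl_dual // eqxx mulr1.
rewrite big1 ?addr0 // => j; rewrite -val_eqE /= => ji.
by rewrite fnl_dual // (negbTE ji) mulr0.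
Qed.

(** At $x = 0$ a relation becomes one between the $L_i$, so every [n i] vanishes at 0. Dividing all
    of them by $x$ gives a relation of lower degree. *)
Lemma moment_free (n : nat -> {poly C}) :
  (forall a, \sum_(i < k) n i * moment i a = 0) -> forall i, (i < k)%N -> n i = 0.
Proof.
move=> H i ik; have [N le_N] : exists N, forall j, (j < k)%N -> (size (n j) <= N)%N.
  by exists (\max_(j < k) size (n j)) => j jk; apply: (leq_bigmax (Ordinal jk)).
elim: N n le_N H i ik => [|N IH] n le_N H i ik.
  by apply/eqP; rewrite -size_poly_leq0 le_N.
have n0 j : (j < k)%N -> (n j).[0] = 0.
  apply: (@fnl_free (fun m => (n m).[0])) => a.
  rewrite -[RHS](horner0 0) -(H a) horner_sum.
  by apply: eq_bigr => m _; rewrite hornerM moment_at0.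
have nE j : (j < k)%N -> n j = 'X * (n j %/ 'X).
  move=> jk; rewrite mulrC divpK // -[X in X %| _]subr0 -polyC0 dvdp_XsubCl.
  by apply/rootP/n0.
rewrite nE // (IH (fun j => n j %/ 'X)) ?mulr0 // => [j jk | a].
  rewrite size_divp ?polyX_eq0 // size_polyX /= subn1 -ltnS.
  by case: (size (n j)) (le_N j jk).
have X0 : 'X != 0 :> {poly C} by rewrite polyX_eq0.
apply: (mulfI X0); rewrite mulr0 -[RHS](H a) mulr_sumr; apply: eq_bigr => j _.
by rewrite mulrA -nE.
Qed.

(* [G = det S v - \sum_j (adj S (L (T v)))_j s_j], for [S = (L_i (T_i s_j))]. *)
Lemma exists_annih_through v : V v ->
  exists G, annih k moment G /\ eval_x 0 G = v.
Proof.
move=> /(fnl_mem D) Vv.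
pose cst (p : {poly C}) : {poly {poly C}} := map_poly polyC p.
have ev p : eval_x 0 (cst p) = p.
  by apply/polyP=> i; rewrite !coef_map /= /horner_eval hornerC.
pose S : 'M[{poly C}]_k := \matrix_(i, j) pairing (moment i) (cst (dvec D j)).
pose w : 'cV[{poly C}]_k := \col_i pairing (moment i) (cst v).
have S0 : map_mx (horner_eval 0) S = 1%:M.
  by apply/matrixP=> i j; rewrite !mxE /= /horner_eval pairing_moment0 ev fnl_dual.
have w0 (i : 'I_k) : (w i 0).[0] = 0.
  by rewrite mxE pairing_moment0 ev Vv.
pose y := \adj S *m w.
have Sy : S *m y = \det S *: w by rewrite mulmxA mul_mx_adj mul_scalar_mx.
exists (\det S *: cst v - \sum_(j < k) y j 0 *: cst (dvec D j)); split.
  move=> i ik; rewrite pairingD pairingZ -scaleN1r pairingZ pairing_sum.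
  have /matrixP/(_ (Ordinal ik) 0) := Sy; rewrite !mxE /= => <-.
  rewrite mulN1r; apply/eqP; rewrite subr_eq0; apply/eqP; apply: eq_bigr => j _.
  by rewrite pairingZ !mxE mulrC.
have evZ c g : eval_x 0 (c *: g) = c.[0] *: eval_x 0 g.
  by rewrite /eval_x map_polyZ.
rewrite /eval_x rmorphB rmorph_sum /= -!/(eval_x _ _) evZ ev.
have -> : (\det S).[0] = 1.
  by have := det_map_mx (horner_eval 0) S; rewrite S0 det1 => ->.
rewrite scale1r big1 ?subr0 // => j _.
rewrite -/(eval_x _ _) evZ mxE horner_sum big1 ?scale0r // => i _.
by rewrite hornerM w0 mulr0.
Qed.

End DualData.

(** * The correspondence between operators in the two variables *)

Section Baker.
Variables (C : numFieldType) (K : fieldType) (e : {rmorphism {poly C} -> K}) (d : K -> K).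
Hypothesis derD : forall a b, d (a + b) = d a + d b.
Hypothesis derM : forall a b, d (a * b) = d a * b + a * d b.
Hypothesis d_e : forall p, d (e p) = e p^`().
Hypothesis e_inj : injective e.
Hypothesis e_frac : forall f, exists a b : {poly C}, b != 0 /\ f = e a / e b.
Implicit Types (f u P E : {poly K}) (a g h G : {poly {poly C}}) (p : {poly C}).
Local Notation emb := (emb e).
Local Notation kappa := (kappa e).
Local Notation tau := (tau d).
Local Notation tw := (tw d).
Local Notation delta := (delta (e 'X)).
Local Notation deltaC := (@deltaC C).
Local Notation tauC := (@tauC C).

Lemma iter_tau_emb n g : iter n tau (emb g) = emb (iter n tauC g).
Proof. by elim: n => //= n ->; rewrite (tau_emb derD d_e). Qed.

Lemma coef0_iter_deltaC n g : (iter n deltaC g)`_0 = eval_x 0 (iter n tauC (swapXY g)).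
Proof. by rewrite -[in LHS](swapXYK (iter n deltaC g)) coef0_swapXY swapXY_iter_deltaC. Qed.

Lemma delta_const p : delta (e p)%:P = (e (p * 'X))%:P.
Proof. by rewrite delta_polyC -rmorphM mulrC. Qed.

Lemma der_constC (c : C) : der_const d (e c%:P)%:P.
Proof.
by apply/polyP=> i; rewrite (coef_derp derD) coefC coef0; case: eqP; rewrite ?d_e ?derivC ?rmorph0 ?(der0 derD).
Qed.

Lemma iter_delta1 n : iter n delta 1 = (e 'X^n)%:P.
Proof. by elim: n => [|n IH]; rewrite ?expr0 ?rmorph1 //= IH delta_const -exprSr. Qed.

(** [delta] is right multiplication of an operator by $x$, so this expands the product of [P] with
    $p(x)$. *)
Lemma tw_e_const P p :
  tw P (e p)%:P = \sum_(n < size p) iter n delta P * (e (p`_n)%:P)%:P.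
Proof.
rewrite {1}(poly_sum_mono p) !rmorph_sum (tw_sumr derD); apply: eq_bigr => n _.
rewrite -mul_polyC mulrC !rmorphM (tw_mul_const derD derM) //; last exact: der_constC.
by rewrite /= -iter_delta1 (tw_iter_delta derD derM) ?(d_eX d_e) // (tw1r derD derM).
Qed.

Definition dact P (w : K) := \sum_(i < size P) P`_i * iter i d w.

Lemma dact_coef0 P u : dact P u`_0 = (tw P u)`_0.
Proof. by rewrite (tw_coef0 derD). Qed.

Lemma dact_e P p : dact P (e p) = \sum_(n < size p) (iter n delta P)`_0 * e (p`_n)%:P.
Proof.
have {1}-> : e p = ((e p)%:P)`_0 by rewrite coefC eqxx.
rewrite dact_coef0 tw_e_const coef_sum; apply: eq_bigr => n _.
by rewrite coefMC.
Qed.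

Section OneSpace.
Variables (V : {poly C} -> Prop) (k : nat) (D : dual_data V k).

Definition momentK i (a : nat) : K := e (moment D i a).

Lemma momentKS i (a : nat) : momentK i a.+1 = d (momentK i a) + e (node D i)%:P * momentK i a.
Proof. by rewrite /momentK momentS rmorphD rmorphM d_e. Qed.

Lemma pairing_emb i g : pairing (momentK i) (emb g) = e (pairing (moment D i) g).
Proof.
rewrite /pairing size_emb // rmorph_sum; apply: eq_bigr => a _.
by rewrite rmorphM coef_map.
Qed.

Lemma annih_emb g : annih k momentK (emb g) <-> annih k (moment D) g.
Proof.
split=> H i ik; last by rewrite pairing_emb H ?rmorph0.
by apply: e_inj; rewrite -pairing_emb H ?rmorph0.
Qed.

Lemma momentK_free (c : nat -> K) :
  (forall a : nat, \sum_(i < k) c i * momentK i a = 0) -> forall i, (i < k)%N -> c i = 0.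
Proof.
move=> H i ik; have [a [h [a0 E]]] := clear_denominators e_inj e_frac (\poly_(i < k) c i).
have cE j : (j < k)%N -> e a * c j = e h`_j.
  by move=> jk; have := congr1 (fun u : {poly K} => u`_j) E; rewrite coefZ coef_poly jk coef_map.
have h0 : h`_i = 0.
  apply: (@moment_free _ _ _ D (fun j => h`_j)) ik => b; apply: e_inj.
  transitivity (e a * \sum_(j < k) c j * momentK j b); last by rewrite H mulr0 rmorph0.
  by rewrite rmorph_sum mulr_sumr; apply: eq_bigr => j _; rewrite rmorphM -cE // mulrA.
move/eqP: (cE i ik); rewrite h0 rmorph0 mulf_eq0 (e_eq0 e_inj) (negbTE a0).
by move/eqP.
Qed.

Lemma annihK_small u : annih k momentK u -> (size u <= k)%N -> u = 0.
Proof. exact: (annih_small_eq0 derD derM momentKS momentK_free). Qed.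

Lemma det_moment_neq0 : \det (\matrix_(a < k, i < k) moment D i a) != 0.
Proof.
rewrite -(e_eq0 e_inj) -det_map_mx.
have -> : map_mx e (\matrix_(a < k, i < k) moment D i a) = \matrix_(a < k, i < k) momentK i a.
  by apply/matrixP=> a i; rewrite !mxE.
exact: det_annih_neq0 annihK_small.
Qed.

Lemma exists_baker_poly : exists Q : {poly {poly C}}, size Q = k.+1 /\ annih k (moment D) Q.
Proof.
have [u [u0 le_u Mu]] := exists_annih k momentK.
have [a [Q [a0 E]]] := clear_denominators e_inj e_frac u.
exists Q; split; last by apply/annih_emb; rewrite -E; apply: annihZ.
rewrite -(size_emb e_inj) -E size_scale ?(e_eq0 e_inj) //.
apply/eqP; rewrite eqn_leq le_u ltnNge; apply: contra u0 => le_uk.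
by apply/eqP/annihK_small.
Qed.

Lemma annih_iter_tauC n g : annih k (moment D) g -> annih k (moment D) (iter n tauC g).
Proof.
move=> Mg; elim: n => //= n /annih_emb IH; apply/annih_emb.
by rewrite -(tau_emb derD d_e); apply: (annih_tau derD derM momentKS).
Qed.

Lemma annih_eval0 g : annih k (moment D) g -> V (eval_x 0 g).
Proof.
by move=> Mg; apply/(fnl_mem D) => i ik; rewrite -pairing_moment0 Mg // horner0.
Qed.

(* All derivatives of [e^{(node i) x} pairing (moment i) g] vanish at [0]. *)
Lemma eval0_annih g : (forall n, V (eval_x 0 (iter n tauC g))) -> annih k (moment D) g.
Proof.
move=> H i ik; pose p n := pairing (moment D i) (iter n tauC g).
have pS n : p n.+1 = (p n)^`() + (node D i)%:P * p n.
  apply: e_inj; rewrite rmorphD rmorphM -d_e /p -!pairing_emb.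
  by rewrite -!iter_tau_emb /= (pairing_tau derD derM _ (momentKS i)).
rewrite -/(p 0%N); suff: forall j n, (p n)`_j = 0.
  by move=> p0; apply/polyP=> j; rewrite p0 coef0.
elim=> [|j IH] n.
  by rewrite -horner_coef0 pairing_moment0; move/(fnl_mem D): (H n); apply.
have := IH n.+1; rewrite pS coefD coef_deriv coefCM IH mulr0 addr0.
by move/eqP; rewrite mulrn_eq0 /= => /eqP.
Qed.

(** [RK] and [LK] are $R_W$ and $L_W$ for $W = m^{-1}V$, over an abstract copy of the rational
    functions. *)
Definition RK (m : {poly C}) E := forall p, exists v, V v /\ dact E (e p) = e v / e m.
Definition LK (m : {poly C}) P :=
  forall w, (exists v, V v /\ w = e v / e m) -> exists p, dact P w = e p.

Variables (m : {poly C}).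
Hypothesis m_neq0 : m != 0.

Let em0 : e m != 0. Proof. by rewrite (e_eq0 e_inj). Qed.

Lemma iter_deltaZ n (c : K) u : iter n delta (c *: u) = c *: iter n delta u.
Proof. by elim: n => //= n ->; rewrite deltaZ. Qed.

(** Up to $n!$, the values of [E] on the $z^n$ are the Taylor coefficients in $x$ at 0 of $E
    e^{xz}$, which is $e^{xz}$ times the symbol of [E]. So [E] maps polynomials into $W$ iff all
    $x$-derivatives at 0 of $e^{xz}$ times the swapped symbol, multiplied by [m], lie in [V]. *)
Lemma RK_symbol E : RK m E <->
  exists g, e m *: E = emb g /\ annih k (moment D) (swapXY g).
Proof.
split=> [RE | [g [Eg Mg]] p].
  have H n : exists v, V v /\ (iter n delta (e m *: E))`_0 = e v.
    have [v [Vv E1]] := RE 'X^n; exists v; split=> //.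
    rewrite iter_deltaZ coefZ -[e v](divfK em0) -E1 mulrC; congr (_ * _).
    have := dact_coef0 E (iter n delta 1).
    rewrite (tw_iter_delta derD derM) ?(d_eX d_e) // (tw1r derD derM) => <-.
    by rewrite iter_delta1 coefC.
  have [n|g Eg] := @intg_of_deltas _ _ e e_inj (e m *: E).
    by have [v [_ ->]] := H n; exists v.
  exists g; split=> //; apply: eval0_annih => n.
  have [v [Vv]] := H n; rewrite Eg (iter_delta_emb e) coef_map => /e_inj vE.
  by rewrite -coef0_iter_deltaC vE.
exists (\sum_(n < size p) p`_n *: (iter n deltaC g)`_0); split.
  apply/(fnl_mem D) => i ik; rewrite fnl_sum big1 // => n _; rewrite fnlZ.
  rewrite coef0_iter_deltaC; have /annih_eval0 /(fnl_mem D) -> // := annih_iter_tauC n Mg.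
  by rewrite mulr0.
apply: (mulIf em0); rewrite divfK // dact_e mulr_suml rmorph_sum; apply: eq_bigr => n _.
rewrite -mul_polyC rmorphM [RHS]mulrC mulrAC; congr (_ * _).
have := congr1 (fun u : {poly K} => (iter n delta u)`_0) Eg.
by rewrite iter_deltaZ coefZ (iter_delta_emb e) coef_map mulrC.
Qed.

End OneSpace.

Lemma swapXY_iter_tauC n g : swapXY (iter n tauC g) = iter n deltaC (swapXY g).
Proof. by rewrite -[in LHS](swapXYK g) -swapXY_iter_deltaC swapXYK. Qed.

Lemma tau_kappa p : tau (kappa p) = kappa p * 'X.
Proof. by rewrite tau_const 1?mulrC //; apply: kappa_const. Qed.

Lemma tw_kappa P p u : tw P (kappa p * u) = kappa p * tw P u.
Proof. by rewrite mulrC (tw_mul_const derD derM) 1?mulrC //; apply: kappa_const. Qed.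

Lemma tw_emb h u : tw (emb h) u = \sum_(j < size h) e h`_j *: iter j tau u.
Proof.
rewrite (@tw_widen _ _ (size h)) ?(size_emb e_inj) //; apply: eq_bigr => j _.
by rewrite coef_map.
Qed.

(* [b] exchanges [X] and [d]: the operator product [g * a] becomes the product
   of [swapXY a] and [swapXY g]. *)
Lemma tw_swap a g : exists g2,
  tw (emb g) (emb a) = emb g2 /\ tw (emb (swapXY a)) (emb (swapXY g)) = emb (swapXY g2).
Proof.
have addP a1 a2 : (exists g2, tw (emb g) (emb a1) = emb g2 /\
      tw (emb (swapXY a1)) (emb (swapXY g)) = emb (swapXY g2)) ->
    (exists g2, tw (emb g) (emb a2) = emb g2 /\
      tw (emb (swapXY a2)) (emb (swapXY g)) = emb (swapXY g2)) ->
    (exists g2, tw (emb g) (emb (a1 + a2)) = emb g2 /\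
      tw (emb (swapXY (a1 + a2))) (emb (swapXY g)) = emb (swapXY g2)).
  move=> [g1 [E1 F1]] [g2 [E2 F2]]; exists (g1 + g2).
  split; first by rewrite !embD (twDr derD) E1 E2.
  by rewrite !rmorphD /= !embD twDl F1 F2.
have zeroP : exists g2, tw (emb g) (emb 0) = emb g2 /\
      tw (emb (swapXY 0)) (emb (swapXY g)) = emb (swapXY g2).
  by exists 0; rewrite !rmorph0 /emb !rmorph0 (tw0r derD) tw0l.
elim/poly_ind: a => [//|a p [ga [Ea Fa]]]; apply: (addP _ _).
  exists (ga * 'X); split.
    by rewrite !embM embX (tw_mul_const derD derM) ?Ea //; apply: der_constX.
  by rewrite !rmorphM /= swapXY_X mulrC mul_polyC emb_swapZ twZl Fa -emb_swapZ -mul_polyC mulrC.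
elim/poly_ind: p => [|p c [gp [Ep Fp]]]; first by rewrite polyC0.
rewrite polyCD; apply: (addP _ _).
  exists (deltaC gp); split.
    rewrite embC -delta_const (tw_delta derD derM) ?(d_eX d_e) // -embC Ep.
    exact: delta_emb.
  rewrite swapXY_deltaC swapXY_polyC rmorphM /= map_polyX embM embX -tau_kappa.
  by rewrite (tw_tau derD derM) -/(kappa p) -(tau_emb derD d_e) -Fp swapXY_polyC.
exists (c%:P%:P * g); split.
  rewrite embC -[(e _)%:P]mul1r (tw_mul_const derD derM) ?(tw1r derD derM); last exact: der_constC.
  by rewrite embM embC mulrC.
rewrite rmorphM /= swapXY_polyC map_polyC /= mul_polyC emb_swapZ embC.
by rewrite twC.
Qed.

(** * Matching operators of a bispectral pair *)

Section TwoSpaces.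
Variables (V V' : {poly C} -> Prop) (k k' : nat) (D : dual_data V k) (D' : dual_data V' k').
Variables (m m' : {poly C}) (Q Q' : {poly {poly C}}).
Hypotheses (m0 : m != 0) (m'0 : m' != 0).
Hypotheses (sQ : size Q = k.+1) (MQ : annih k (moment D) Q).
Hypotheses (sQ' : size Q' = k'.+1) (MQ' : annih k' (moment D') Q').
(* [Q'(x, z) / (Delta'(x) m'(z)) = Q(z, x) / (Delta(z) m(x))] *)
Hypothesis bispectral : Q' * map_poly polyC (lead_coef Q) * m%:P =
  swapXY Q * (lead_coef Q')%:P * map_poly polyC m'.

(** [q'] is $e^{-xz} m'(z) \psi_{b(W)}(x,z)$, and [qh] is $e^{-xz} \Delta(z) \psi_W(z,x)$. *)
Let q' : {poly K} := (e (lead_coef Q'))^-1 *: emb Q'.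
Let qh : {poly K} := (e m)^-1 *: emb (swapXY Q).

Let Q0 : Q != 0. Proof. by rewrite -size_poly_gt0 sQ. Qed.
Let Q'0 : Q' != 0. Proof. by rewrite -size_poly_gt0 sQ'. Qed.
Let lQ0 : lead_coef Q != 0. Proof. by rewrite lead_coef_eq0. Qed.
Let elQ'0 : e (lead_coef Q') != 0. Proof. by rewrite (e_eq0 e_inj) lead_coef_eq0. Qed.
Let em0 : e m != 0. Proof. by rewrite (e_eq0 e_inj). Qed.
Let em'0 : e m' != 0. Proof. by rewrite (e_eq0 e_inj). Qed.

Let sq' : size q' = k'.+1.
Proof. by rewrite size_scale ?invr_eq0 // (size_emb e_inj). Qed.

Let q'0 : q' != 0. Proof. by rewrite -size_poly_gt0 sq'. Qed.

Let Mq' : annih k' (momentK D') q'.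
Proof. by apply: annihZ; apply/annih_emb. Qed.

Let bispectralK : kappa (lead_coef Q) * q' = kappa m' * qh.
Proof.
have := congr1 emb bispectral; rewrite !embM !embC -!/(kappa _) => E.
have im0 : ((e m)^-1)%:P * (e m)%:P = 1 by rewrite -polyCM mulVf.
have il0 : ((e (lead_coef Q'))^-1)%:P * (e (lead_coef Q'))%:P = 1 by rewrite -polyCM mulVf.
rewrite /q' /qh -!mul_polyC.
rewrite -[LHS]mulr1 -im0 -[RHS]mulr1 -il0.
transitivity (((e m)^-1)%:P * ((e (lead_coef Q'))^-1)%:P *
  (emb Q' * kappa (lead_coef Q) * (e m)%:P)); last rewrite E; ring.
Qed.

(** $E(z,\partial_z) e^{xz} = P(x,\partial_x) \psi_{b(W)}(x,z)$, multiplied by $m'(z) e^{-xz}$. The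
    coefficients of [E] and [P] live in the same [K] but depend on different variables; the two
    sides can be compared only through a polynomial symbol [g], which [swapXY] carries from one
    reading to the other. *)
Definition bispectral_rel E P := exists g,
  e m' *: E = emb g /\ tw P q' = emb (swapXY g).

Lemma bispectral_rel_uniql E1 E2 P : bispectral_rel E1 P -> bispectral_rel E2 P -> E1 = E2.
Proof.
move=> [g1 [e1 f1]] [g2 [e2]]; rewrite f1 => /(emb_inj e_inj) /(can_inj swapXYK) g12.
by apply: (scalerI em'0); rewrite e1 e2 g12.
Qed.

Lemma bispectral_rel_uniqr E P1 P2 : bispectral_rel E P1 -> bispectral_rel E P2 -> P1 = P2.
Proof.
move=> [g1 [e1 f1]] [g2 [e2 f2]]; apply/eqP; rewrite -subr_eq0; apply/eqP.
apply: (@tw_eq0 _ d _ _ q'0); rewrite twBl f1 f2.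
by move: e1; rewrite e2 => /(emb_inj e_inj) ->; rewrite subrr.
Qed.

Lemma bispectral_relD E1 E2 P1 P2 :
  bispectral_rel E1 P1 -> bispectral_rel E2 P2 -> bispectral_rel (E1 + E2) (P1 + P2).
Proof.
move=> [g1 [e1 f1]] [g2 [e2 f2]]; exists (g1 + g2).
by rewrite scalerDr e1 e2 twDl f1 f2 rmorphD -!embD.
Qed.

Lemma bispectral_rel_mul E P a :
  bispectral_rel E P -> bispectral_rel (tw E (emb a)) (tw (emb (swapXY a)) P).
Proof.
move=> [g [eg fg]]; have [g2 [E1 E2]] := tw_swap a g.
by exists g2; rewrite -twZl eg E1 (tw_tw derD derM) fg E2.
Qed.

Lemma bispectral_rel_RK E P : bispectral_rel E P -> RK V' m' E.
Proof.
move=> [g [eg fg]]; apply/(RK_symbol D' m'0); exists g; split=> //.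
by apply/annih_emb; rewrite -fg; apply: (annih_tw derD derM (momentKS D')).
Qed.

Lemma RK_bispectral_rel E : RK V' m' E -> exists P, bispectral_rel E P.
Proof.
move/(RK_symbol D' m'0) => [g [eg /annih_emb Mg]].
have [P gP] := annih_generator derD derM (momentKS D') (momentK_free (D := D')) Mq' sq' Mg.
by exists P, g; rewrite -gP.
Qed.

Let twqh_of_twq' P : intg e (tw P q') -> intg e (tw P qh).
Proof.
move=> I; apply: (intg_of_kappaM e_inj m'0).
rewrite -tw_kappa -bispectralK tw_kappa.
by apply: intgM => //; exists (map_poly polyC (lead_coef Q)).
Qed.

Let twq'_of_twqh P : intg e (tw P qh) -> intg e (tw P q').
Proof.
move=> I; apply: (intg_of_kappaM e_inj lQ0).
rewrite -tw_kappa bispectralK tw_kappa.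
by apply: intgM => //; exists (map_poly polyC m').
Qed.

Let iter_delta_qh n : iter n delta qh = (e m)^-1 *: emb (swapXY (iter n tauC Q)).
Proof. by rewrite iter_deltaZ (iter_delta_emb e) swapXY_iter_tauC. Qed.

(** A given [v] in [V] is the value at 0 of a solution [G], which is an operator over $C(x)$ applied
    to [Q]. After the swap this operator acts by [delta] and by multiplication with polynomials in
    $z$, both of which commute with [P]; so integrality passes from [qh] to the swapped [G], whose
    constant term is [v / m]. *)
Lemma bispectral_rel_LK E P : bispectral_rel E P -> LK V m P.
Proof.
move=> [g [_ fg]] _ [v [Vv ->]].
have [f fE] : intg e (tw P qh) by apply: twqh_of_twq'; exists (swapXY g).
have [G [MG vG]] := exists_annih_through D Vv.
have MQK : annih k (momentK D) (emb Q) by apply/annih_emb.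
have MGK : annih k (momentK D) (emb G) by apply/annih_emb.
have sQK : size (emb Q) = k.+1 by rewrite (size_emb e_inj).
have [A GA] := annih_generator derD derM (momentKS D) (momentK_free (D := D)) MQK sQK MGK.
have [a [h [a0 hE]]] := clear_denominators e_inj e_frac A.
have aG : a *: G = \sum_(j < size h) h`_j *: iter j tauC Q.
  apply: (emb_inj e_inj); rewrite emb_swapZ GA -twZl hE tw_emb.
  rewrite emb_sum; apply: eq_bigr => j _.
  by rewrite emb_swapZ iter_tau_emb.
pose Gh := (e m)^-1 *: emb (swapXY G).
have aGh : kappa a * Gh = \sum_(j < size h) kappa h`_j * iter j delta qh.
  rewrite -scalerAr -embM -swapXY_polyC -rmorphM mul_polyC aG rmorph_sum emb_sum scaler_sumr.
  apply: eq_bigr => j _; rewrite iter_delta_qh -scalerAr; congr (_ *: _).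
  by rewrite -mul_polyC rmorphM /= swapXY_polyC embM.
have [u uE] : intg e (tw P Gh).
  (* The denominator [a] of the operator has become a polynomial in $z$ and cancels. *)
  apply: (intg_of_kappaM e_inj a0).
  rewrite -tw_kappa aGh (tw_sumr derD); apply: intg_sum => j _; rewrite tw_kappa.
  rewrite (tw_iter_delta derD derM) ?(d_eX d_e) // fE (iter_delta_emb e).
  by exists (map_poly polyC h`_j * iter j deltaC f); rewrite embM.
exists u`_0; rewrite -(coef_map e) -[map_poly _ _]uE -dact_coef0; congr (dact _ _).
by rewrite coefZ coef_map coef0_swapXY vG mulrC.
Qed.

(** The constant terms of [iter n delta qh] are elements of $W$, so [P] maps them to polynomials,
    which is the criterion of [intg_of_deltas] for [tw P qh]. *)
Lemma LK_bispectral_rel P : LK V m P -> exists E, bispectral_rel E P.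
Proof.
move=> LP; have [|g gE] := @twq'_of_twqh P.
  apply: (intg_of_deltas e_inj) => n.
  rewrite -(tw_iter_delta derD derM) ?(d_eX d_e) // -dact_coef0; apply: LP.
  exists (eval_x 0 (iter n tauC Q)); split; first exact/(annih_eval0 (D := D))/annih_iter_tauC.
  by rewrite iter_delta_qh coefZ coef_map coef0_swapXY mulrC.
exists ((e m')^-1 *: emb (swapXY g)), (swapXY g).
by rewrite scalerA divff // scale1r swapXYK.
Qed.

Theorem bispectral_isomorphism :
  exists phi : {poly K} -> {poly K},
    [/\ forall E, RK V' m' E -> LK V m (phi E),
        forall E1 E2, RK V' m' E1 -> RK V' m' E2 -> phi E1 = phi E2 -> E1 = E2,
        forall P, LK V m P -> exists2 E, RK V' m' E & phi E = P,
        forall E1 E2, RK V' m' E1 -> RK V' m' E2 -> phi (E1 + E2) = phi E1 + phi E2 &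
        forall E a, RK V' m' E -> phi (tw E (emb a)) = tw (emb (swapXY a)) (phi E)].
Proof.
have /choice [phi phiP] : forall E, exists P, RK V' m' E -> bispectral_rel E P.
  move=> E; have [/RK_bispectral_rel [P EP] | nRE] := pselect (RK V' m' E); first by exists P.
  by exists 0 => /nRE.
have phi_uniq E P : bispectral_rel E P -> phi E = P.
  by move=> EP; apply: (bispectral_rel_uniqr (phiP _ (bispectral_rel_RK EP))).
exists phi; split.
- by move=> E /phiP /bispectral_rel_LK.
- by move=> E1 E2 /phiP EP1 /phiP + E12; rewrite -E12; apply: bispectral_rel_uniql.
- move=> P /LK_bispectral_rel [E EP]; exists E; first exact: bispectral_rel_RK EP.
  exact: phi_uniq.
- by move=> E1 E2 /phiP EP1 /phiP EP2; apply/phi_uniq/bispectral_relD.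
- by move=> E a /phiP EP; apply/phi_uniq/bispectral_rel_mul.
Qed.

End TwoSpaces.

End Baker.

(** * Rational functions and primary decompositions *)

Section QuotientRule.
Variables (C : fieldType) (K : fieldType) (e : {rmorphism {poly C} -> K}) (d : K -> K).
Hypothesis e_inj : injective e.
Hypothesis e_frac : forall f, exists a b : {poly C}, b != 0 /\ f = e a / e b.

Let e_neq0 q : q != 0 -> e q != 0.
Proof. by apply: contra_neq => E; apply: e_inj; rewrite E rmorph0. Qed.

Lemma eq_frac p q n m : q != 0 -> m != 0 -> (e p / e q = e n / e m) <-> p * m = n * q.
Proof.
move=> /e_neq0 q0 /e_neq0 m0; split=> [/eqP | E].
  by rewrite eqr_div // -!(rmorphM e) => /eqP /e_inj.
by apply/eqP; rewrite eqr_div // -!(rmorphM e) E.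
Qed.

Hypothesis d_frac : forall p q : {poly C}, q != 0 ->
  d (e p / e q) = e (p^`() * q - p * q^`()) / e (q ^+ 2).

Lemma quotient_rule_e p : d (e p) = e p^`().
Proof.
have -> : e p = e p / e 1 by rewrite rmorph1 divr1.
by rewrite d_frac ?oner_eq0 // derivC mulr0 subr0 mulr1 expr1n rmorph1 divr1.
Qed.

Lemma quotient_rule_add a b : d (a + b) = d a + d b.
Proof.
have [p [q [q0 ->]]] := e_frac a; have [r [s [s0 ->]]] := e_frac b.
have eq0 := e_neq0 q0; have es0 := e_neq0 s0.
have -> : e p / e q + e r / e s = e (p * s + r * q) / e (q * s).
  by rewrite !(rmorphM e, rmorphD e); field; rewrite eq0 es0.
rewrite !d_frac ?mulf_neq0 // derivD !derivM !(rmorphB e, rmorphXn e, rmorphM e, rmorphD e).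
by field; rewrite eq0 es0.
Qed.

Lemma quotient_rule_mul a b : d (a * b) = d a * b + a * d b.
Proof.
have [p [q [q0 ->]]] := e_frac a; have [r [s [s0 ->]]] := e_frac b.
have eq0 := e_neq0 q0; have es0 := e_neq0 s0.
have -> : e p / e q * (e r / e s) = e (p * r) / e (q * s).
  by rewrite !(rmorphM e); field; rewrite eq0 es0.
rewrite !d_frac ?mulf_neq0 // !derivM !(rmorphB e, rmorphXn e, rmorphM e, rmorphD e).
by field; rewrite eq0 es0.
Qed.

End QuotientRule.

Section FractionDerivative.
Variable C : fieldType.
Local Notation tofrac := (@FracField.tofrac {poly C}).
Local Notation K := {fraction {poly C}}.

Lemma frac_repr (x : K) : x = tofrac (\n_(repr x)) / tofrac (\d_(repr x)).
Proof.
have d0 : tofrac (\d_(repr x)) != 0 by rewrite tofrac_eq0 denom_ratioP.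
apply: (mulIf d0); rewrite divfK // -{1}[x]reprK; move: (repr x) => r.
unlock FracField.tofrac; rewrite -[LHS]FracField.pi_mul /FracField.mulf; apply/eqmodP.
rewrite /= FracField.equivfE !numden_Ratio ?mulf_neq0 ?oner_eq0 ?denom_ratioP //.
by rewrite !mulr1 mulrC.
Qed.

Lemma frac_exists (x : K) : exists a b : {poly C}, b != 0 /\ x = tofrac a / tofrac b.
Proof. by exists \n_(repr x), \d_(repr x); rewrite denom_ratioP; split=> //; apply: frac_repr. Qed.

Lemma tofrac_inj : injective tofrac.
Proof. by move=> p q /eqP; rewrite tofrac_eq => /eqP. Qed.

Definition derivF (f : K) : K :=
  let r := repr f in
  tofrac ((\n_r)^`() * \d_r - \n_r * (\d_r)^`()) / tofrac (\d_r ^+ 2).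

(** Independence of the representative: differentiate the cross-multiplied equality of the two
    fractions. *)
Lemma derivF_frac (p q : {poly C}) : q != 0 ->
  derivF (tofrac p / tofrac q) = tofrac (p^`() * q - p * q^`()) / tofrac (q ^+ 2).
Proof.
move=> q0; have m0 : \d_(repr (tofrac p / tofrac q)) != 0 by rewrite denom_ratioP.
have [E _] := eq_frac tofrac_inj p \n_(repr (tofrac p / tofrac q)) q0 m0.
have {}E := E (frac_repr _).
rewrite /derivF; move: (\n_ _) (\d_ _) m0 E => n m m0 E.
apply/(eq_frac tofrac_inj); [exact: expf_neq0 | exact: expf_neq0 |].
have E' := congr1 (@deriv C) E; rewrite !derivM in E'.
have -> : (n^`() * m - n * m^`()) * q ^+ 2 =
    m * q * (n^`() * q + n * q^`()) - m * q^`() * (n * q) - n * q * q * m^`() by ring.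
by rewrite -E' -E; ring.
Qed.

End FractionDerivative.

(** * Dual functionals from a primary decomposition *)

Section PrimaryDual.
Variable C : numFieldType.
Variables (U : {poly C} -> Prop) (lam : C) (r : nat) (s : seq {poly C}).
Hypotheses (U0 : U 0) (UD : forall p q, U p -> U q -> U (p + q)).
Hypothesis (UZ : forall (c : C) p, U p -> U (c *: p)).
Hypothesis Ulam : forall p, (('X - lam%:P) ^+ r %| p) -> U p.
Hypothesis s_span : forall p : {poly C},
  exists c : seq C, U (p - \sum_(i < size s) c`_i *: s`_i).
Hypothesis s_min : forall s' : seq {poly C},
  (forall p : {poly C}, exists c : seq C, U (p - \sum_(i < size s') c`_i *: s'`_i)) ->
  (size s <= size s')%N.

Let UB p q : U p -> U q -> U (p - q).
Proof. by move=> Up Uq; rewrite -scaleN1r; apply: UD => //; apply: UZ. Qed.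

Lemma minimal_span_free (c : nat -> C) :
  U (\sum_(i < size s) c i *: s`_i) -> forall i, (i < size s)%N -> c i = 0.
Proof.
move=> Uc i0 i0s; apply/eqP/negPn/negP => c0.
pose idx := [seq j <- iota 0 (size s) | j != i0].
have sz : (size idx < size s)%N.
  rewrite size_filter -[X in (_ < X)%N](size_iota 0) -(count_predC (fun j => j != i0)).
  rewrite -[X in (X < _)%N]addn0 ltn_add2l -has_count; apply/hasP.
  by exists i0; rewrite ?mem_iota //= negbK.
pose s' := [seq s`_j | j <- idx].
have : (size s <= size s')%N; last by rewrite size_map leqNgt sz.
apply: s_min => p; have [b Ub] := s_span p.
pose t := b`_i0 / c i0; pose g j := b`_j - t * c j.
exists [seq g j | j <- idx].
have -> : \sum_(i < size s') [seq g j | j <- idx]`_i *: s'`_i = \sum_(j <- idx) g j *: s`_j.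
  rewrite size_map [RHS](big_nth 0%N) big_mkord; apply: eq_bigr => j _.
  by rewrite !(nth_map 0%N).
rewrite big_filter.
have -> : iota 0 (size s) = index_iota 0 (size s) by rewrite /index_iota subn0.
rewrite big_mkord.
have -> : \sum_(i < size s | (i : nat) != i0) g i *: s`_i = \sum_(i < size s) g i *: s`_i.
  rewrite [RHS](bigD1 (Ordinal i0s)) //= /g /t divfK // subrr scale0r add0r.
  by apply: eq_bigl => j; rewrite -val_eqE.
have -> : p - \sum_(i < size s) g i *: s`_i =
    (p - \sum_(i < size s) b`_i *: s`_i) + t *: \sum_(i < size s) c i *: s`_i.
  rewrite -addrA; congr (_ + _); rewrite [RHS]addrC -[RHS]opprB scaler_sumr; congr (- _).
  rewrite -sumrB; apply: eq_bigr => i _.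
  by rewrite scalerA -scalerBl.
by apply: UD => //; apply: UZ.
Qed.

(** The functionals are the coordinates modulo [U] with respect to the minimal spanning list, which
    is itself the dual family. *)
Lemma primary_dual_data : exists D : dual_data U (size s),
  forall i, (i < size s)%N -> node D i = lam.
Proof.
have [cf cfP] := choice s_span.
have uniq_cf (a : nat -> C) p : U (p - \sum_(i < size s) a i *: s`_i) ->
    forall i, (i < size s)%N -> (cf p)`_i = a i.
  move=> Ua i iS; apply/eqP; rewrite -subr_eq0; apply/eqP.
  apply: (@minimal_span_free (fun i => (cf p)`_i - a i)) iS.
  have -> : \sum_(i < size s) ((cf p)`_i - a i) *: s`_i =
      (p - \sum_(i < size s) a i *: s`_i) - (p - \sum_(i < size s) (cf p)`_i *: s`_i).
    rewrite opprB addrC addrA subrK -sumrB.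
    by apply: eq_bigr => j _; rewrite scalerBl.
  exact: UB.
pose L i p := if (i < size s)%N then (cf p)`_i else 0.
have LU p : U p <-> forall i, (i < size s)%N -> L i p = 0.
  split=> [Up i iS | L0].
    rewrite /L iS (uniq_cf (fun=> 0)) // big1 ?subr0 // => j _.
    by rewrite scale0r.
  have := cfP p; rewrite big1 ?subr0 // => i _.
  by have := L0 i (ltn_ord i); rewrite /L ltn_ord => ->; rewrite scale0r.
have Llin i c p q : L i (c *: p + q) = c * L i p + L i q.
  rewrite /L; case: ifP => iS; last by rewrite mulr0 addr0.
  rewrite (uniq_cf (fun j => c * (cf p)`_j + (cf q)`_j)) //.
  have -> : c *: p + q - \sum_(j < size s) (c * (cf p)`_j + (cf q)`_j) *: s`_j =
      c *: (p - \sum_(j < size s) (cf p)`_j *: s`_j) +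
      (q - \sum_(j < size s) (cf q)`_j *: s`_j).
    rewrite scalerBr addrACA -opprD; congr (_ - _).
    rewrite scaler_sumr -big_split /=; apply: eq_bigr => j _.
    by rewrite scalerDl scalerA.
  by apply: UD => //; apply: UZ.
have Lkill i p : L i (('X - lam%:P) ^+ r * p) = 0.
  have [iS | ] := ltnP i (size s); last by rewrite /L ltnNge => ->.
  by move: i iS; apply/LU/Ulam/dvdp_mulIl.
have Ldual i j : (i < size s)%N -> (j < size s)%N -> L i s`_j = (i == j)%:R.
  move=> iS jS; rewrite /L iS (uniq_cf (fun i => (i == j)%:R)) //.
  rewrite (bigD1 (Ordinal jS)) //= eqxx scale1r big1 ?addr0 ?subrr // => l.
  by rewrite -val_eqE /= => /negbTE ->; rewrite scale0r.
by exists (@DualData _ U (size s) L (fun=> lam) (fun=> r) (nth 0 s) Llin Lkill Ldual LU).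
Qed.

End PrimaryDual.

Section CombineDual.
Variable C : numFieldType.
Variables (U V W : {poly C} -> Prop) (k1 k2 : nat) (lam : C).
Variables (D1 : dual_data U k1) (D2 : dual_data V k2).
Hypothesis WE : forall p, W p <-> U p /\ V p.
Hypothesis node1 : forall i, (i < k1)%N -> node D1 i = lam.
Hypothesis node2 : forall i, (i < k2)%N -> node D2 i != lam.

Lemma combine_dual_data : exists D : dual_data W (k1 + k2),
  forall i, (i < k1 + k2)%N ->
    node D i = lam \/ exists2 j, (j < k2)%N & node D i = node D2 j.
Proof.
(* A common exponent, so that all functionals of [D1] kill the multiples of [PA]. *)
pose R := (\max_(i < k1) mult D1 i)%N.
pose PA := ('X - lam%:P) ^+ R; pose PB := \prod_(i < k2) ('X - (node D2 i)%:P) ^+ mult D2 i.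
have killA i p : (i < k1)%N -> fnl D1 i (PA * p) = 0.
  move=> ik; rewrite /PA -(node1 ik); apply: fnl_kill_ge.
  exact: (leq_bigmax (Ordinal ik)).
have killB i p : (i < k2)%N -> fnl D2 i (PB * p) = 0.
  by move=> ik; rewrite /PB (bigD1 (Ordinal ik)) //= -mulrA fnl_kill.
have /Bezout_eq1_coprimepP [[u v] /= uv] : coprimep PA PB.
  rewrite coprimep_expl // coprimep_sym coprimep_XsubC /root horner_prod.
  apply/prodf_neq0 => i _; rewrite horner_exp hornerXsubC expf_neq0 // subr_eq0 eq_sym.
  exact: node2.
pose L i := if (i < k1)%N then fnl D1 i else fnl D2 (i - k1).
pose nd i := if (i < k1)%N then node D1 i else node D2 (i - k1).
pose mu i := if (i < k1)%N then mult D1 i else mult D2 (i - k1).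
(* Chinese remainders: [v * PB] is 1 modulo [PA] and 0 modulo [PB], and conversely for [u * PA], so
   each dual vector is made invisible to the other family. *)
pose s i := if (i < k1)%N then v * PB * dvec D1 i else u * PA * dvec D2 (i - k1).
have Llin i c p q : L i (c *: p + q) = c * L i p + L i q.
  by rewrite /L; case: ifP => _; apply: fnl_linear.
have Lkill i p : L i (('X - (nd i)%:P) ^+ mu i * p) = 0.
  by rewrite /L /nd /mu; case: ifP => _; apply: fnl_kill.
have sub2 i : (i < k1 + k2)%N -> (i < k1)%N = false -> (i - k1 < k2)%N.
  by move=> ik /negbT; rewrite -leqNgt => le; rewrite ltn_subLR.
have Ldual i j : (i < k1 + k2)%N -> (j < k1 + k2)%N -> L i (s j) = (i == j)%:R.
  move=> ik jk; rewrite /L /s; case i1: (i < k1)%N; case j1: (j < k1)%N.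
  - have -> : v * PB * dvec D1 j = dvec D1 j + PA * (- u * dvec D1 j).
      have -> : v * PB = 1 - u * PA by rewrite -uv addrC addKr.
      ring.
    by rewrite fnlD killA // addr0 fnl_dual.
  - rewrite [u * PA]mulrC -mulrA killA //.
    by case: eqP j1 => // <-; rewrite i1.
  - rewrite [v * PB]mulrC -mulrA killB ?sub2 //.
    by case: eqP i1 => // ->; rewrite j1.
  - have -> : u * PA * dvec D2 (j - k1) = dvec D2 (j - k1) + PB * (- v * dvec D2 (j - k1)).
      have -> : u * PA = 1 - v * PB by rewrite -uv addrK.
      ring.
    rewrite fnlD killB ?sub2 // addr0 fnl_dual ?sub2 //.
    move/negbT: i1; move/negbT: j1; rewrite -!leqNgt => j1 i1.
    by rewrite -(eqn_add2r k1) !subnK.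
have LW p : W p <-> forall i, (i < k1 + k2)%N -> L i p = 0.
  rewrite WE (fnl_mem D1) (fnl_mem D2) /L; split=> [[H1 H2] i ik | H].
    by case: ifP => i1; [apply: H1 | apply/H2/sub2].
  split=> i ik; first by have := H i (ltn_addr _ ik); rewrite ik.
  by have := H (k1 + i)%N; rewrite ltn_add2l ik ltnNge leq_addr /= addKn; apply.
exists (@DualData _ W (k1 + k2) L nd mu s Llin Lkill Ldual LW) => i ik /=.
rewrite /nd; case: ifP => i1; first by left; apply: node1.
by right; exists (i - k1)%N; first exact: sub2.
Qed.

End CombineDual.

Section Pdata.
Variable R : realType.
Local Notation C := R[i].

Lemma pdata_dual_data (d : pdata R) : valid_pdata d ->
  exists D : dual_data (Vof d) (\sum_(t <- d) t.2),
    forall i, (i < \sum_(t <- d) t.2)%N -> node D i \in [seq t.1.1 | t <- d].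
Proof.
elim: d => [|t d IH] [/= uniq_d valid_d].
  rewrite big_nil.
  have LV (p : {poly C}) : Vof [::] p <-> forall i, (i < 0)%N -> (0 : C) = 0.
    by split=> // _ t [].
  by exists (@DualData _ (Vof [::]) 0 (fun _ _ => 0) (fun=> 0) (fun=> 0%N) (fun=> 0)
    (fun _ c _ _ => esym (etrans (addr0 _) (mulr0 c))) (fun _ _ => erefl)
    (fun i j (hi : (i < 0)%N) => False_ind _ (notF hi)) LV).
move: uniq_d => /andP [tNd uniq_d].
have [|D2 node2] := IH; first by split=> // t' t'd; apply: valid_d; right.
have [[[U0 UD UZ] [r Ulam]] [[s [ss s_span]] s_min]] := valid_d t (or_introl erefl).
have [|D1 node1] := primary_dual_data U0 UD UZ Ulam s_span.
  by move=> s' /s_min; rewrite ss.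
rewrite ss in D1 node1; rewrite big_cons.
have [|i ik|D nodeD] := @combine_dual_data _ _ _ (Vof (t :: d)) _ _ _ D1 D2 _ node1.
- move=> p; split=> [H | [H1 H2] t' [<- //|]]; last exact: H2.
  by split=> [|t' t'd]; apply: H; [left | right].
- by apply: contraNneq tNd => <-; apply: node2.
exists D => i /nodeD [-> | [j jk ->]]; rewrite inE ?eqxx //.
by rewrite node2 // orbT.
Qed.

Lemma mV_monic (d : pdata R) : mV d \is monic.
Proof. by apply: monic_prod => t _; rewrite monic_exp // monicXsubC. Qed.

Lemma size_mV (d : pdata R) : size (mV d) = (\sum_(t <- d) t.2).+1.
Proof.
rewrite /mV; elim: d => [|t d IH]; first by rewrite !big_nil size_poly1.
rewrite !big_cons size_mul ?monic_neq0 ?monic_exp ?monicXsubC //; last exact: mV_monic.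
by rewrite size_exp_XsubC IH addnS.
Qed.

End Pdata.

(** * Closures in the space of entire functions *)

Section ExpSum.
Variable F : numFieldType.
Implicit Types (a b w : F) (m n : nat).

Definition expsum n w := \sum_(j < n) w ^+ j / j`!%:R.

Lemma expsum0 w : expsum 0 w = 0.
Proof. exact: big_ord0. Qed.

Lemma expsumS n w : expsum n.+1 w = expsum n w + w ^+ n / n`!%:R.
Proof. by rewrite /expsum big_ord_recr. Qed.

Let fact_neq0 n : (n`!%:R : F) != 0.
Proof. by rewrite pnatr_eq0 -lt0n fact_gt0. Qed.

Let fact_ge0 n : 0 <= (n`!%:R)^-1 :> F.
Proof. by rewrite invr_ge0 ler0n. Qed.

Lemma expsum_tail m n w : (m <= n)%N ->
  `|expsum n w - expsum m w| <= expsum n `|w| - expsum m `|w|.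
Proof.
elim: n => [|n IH]; first by rewrite leqn0 => /eqP ->; rewrite !subrr normr0.
rewrite leq_eqVlt => /predU1P [-> | ]; first by rewrite !subrr normr0.
rewrite ltnS => /IH {}IH; rewrite !expsumS ![expsum n _ + _]addrC -!addrA.
apply: le_trans (ler_normD _ _) _; apply: lerD => //.
by rewrite normrM normrX normfV [`|_%:R|]ger0_norm ?ler0n.
Qed.

Lemma expsum_add n a b :
  expsum n (a + b) = \sum_(i < n) a ^+ i / i`!%:R * expsum (n - i) b.
Proof.
elim: n => [|n IH]; first by rewrite /expsum !big_ord0.
have E (i : 'I_n.+1) : a ^+ i / i`!%:R * expsum (n.+1 - i) b =
    a ^+ i / i`!%:R * expsum (n - i) b + (b ^+ (n - i) * a ^+ i) *+ 'C(n, i) / n`!%:R.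
  have iN : (i <= n)%N by rewrite -ltnS.
  rewrite subSn // expsumS mulrDr; congr (_ + _).
  have C0 : ('C(n, i)%:R : F) != 0 by rewrite pnatr_eq0 -lt0n bin_gt0.
  have -> : (n`!%:R : F) = 'C(n, i)%:R * (i`!%:R * (n - i)`!%:R).
    by rewrite -!natrM bin_fact.
  have i0 := fact_neq0 i; have ni0 := fact_neq0 (n - i).
  by rewrite -[_ *+ _]mulr_natr; field; rewrite C0 i0 ni0.
rewrite (eq_bigr _ (fun i _ => E i)) big_split /= big_ord_recr /= subnn.
rewrite expsum0 mulr0 addr0 -IH expsumS; congr (_ + _).
by rewrite -mulr_suml addrC exprDn.
Qed.

Lemma expsum_mul_sub n a b : expsum n a * expsum n b - expsum n (a + b) =
  \sum_(i < n) a ^+ i / i`!%:R * (expsum n b - expsum (n - i) b).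
Proof.
rewrite expsum_add {1}/expsum mulr_suml -sumrB.
by apply: eq_bigr => i _; rewrite mulrBr.
Qed.

(** The error is a polynomial in [a] and [b] with nonnegative coefficients, so its value at the
    moduli bounds it. This reduces complex estimates to the real exponential series. *)
Lemma expsum_mul n a b : `|expsum n a * expsum n b - expsum n (a + b)| <=
  expsum n `|a| * expsum n `|b| - expsum n (`|a| + `|b|).
Proof.
rewrite !expsum_mul_sub; apply: le_trans (ler_norm_sum _ _ _) _.
apply: ler_sum => i _; rewrite normrM normrM normrX normfV [`|_%:R|]ger0_norm ?ler0n //.
apply: ler_wpM2l; first by rewrite mulr_ge0 ?exprn_ge0.
exact/expsum_tail/leq_subr.
Qed.

Definition exppoly n : {poly F} := \poly_(j < n) (j`!%:R)^-1.

Lemma horner_exppoly n w : (exppoly n).[w] = expsum n w.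
Proof. by rewrite horner_poly; apply: eq_bigr => j _; rewrite mulrC. Qed.

Lemma exppoly_comp n (x : F) (p : {poly F}) :
  exppoly n \Po (x *: p) = \sum_(j < n) (x ^+ j / j`!%:R) *: p ^+ j.
Proof.
rewrite /exppoly poly_def rmorph_sum /=; apply: eq_bigr => j _.
by rewrite comp_polyZ comp_Xn_poly exprZn scalerA mulrC.
Qed.

End ExpSum.

(** * Bounds for functionals by suprema on unit circles *)

Section CauchyEstimate.
Variable C : numClosedFieldType.
Implicit Types (p : {poly C}) (M : C).

(* Averaging [p] over [w] and [-w] leaves a polynomial in [w ^+ 2] of half the degree. *)
Lemma norm_at0_le p M : (forall w, `|w| = 1 -> `|p.[w]| <= M) -> `|p.[0]| <= M.
Proof.
have [n] := ubnP (size p); elim: n p => // n IH p le_pn H.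
have [le1 | gt1] := leqP (size p) 1.
  by have := H 1 (normr1 _); rewrite (size1_polyC le1) !hornerC.
have -> : p.[0] = (even_poly p).[0] by rewrite !horner_coef0 coef_even_poly.
apply: IH => [|w w1].
  apply: leq_ltn_trans (size_even_poly p) _.
  rewrite ltnS in le_pn; apply: leq_trans le_pn.
  by rewrite uphalfE ltn_half_double -addnn; case: (size p) gt1 => [|[|m]] // _; rewrite addSn addnS !ltnS leq_addl.
pose u := sqrtC w; have u2 : u ^+ 2 = w by rewrite sqrtCK.
have u1 : `|u| = 1.
  by apply/eqP; rewrite -(@pexpr_eq1 _ _ 2) ?normr_ge0 // -normrX u2 w1.
have E : (even_poly p).[w] * 2%:R = p.[u] + p.[- u].
  rewrite -[p in RHS]poly_even_odd !hornerD !hornerM !hornerX !horner_comp !hornerXn sqrrN u2.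
  ring.
rewrite -(ler_pM2r (ltr0n _ 2 : 0 < 2%:R :> C)) -[X in `|_| * X]normr_nat -normrM E.
apply: le_trans (ler_normD _ _) _; rewrite mulr_natr mulr2n.
by apply: lerD; apply: H; rewrite ?normrN.
Qed.

Lemma norm_center_le p lam M : (forall w, `|w - lam| = 1 -> `|p.[w]| <= M) -> `|p.[lam]| <= M.
Proof.
move=> H; have -> : p.[lam] = (p \Po ('X + lam%:P)).[0] by rewrite horner_comp !hornerE.
apply: norm_at0_le => w w1; rewrite horner_comp !hornerE; apply: H.
by rewrite addrK.
Qed.

(** Induction on [r] through $p = p(\lambda) + (z-\lambda) p_1$. On the unit circle $|p_1| = |p -
    p(\lambda)| \le 2M$, whence the factor 2 in the constant. *)
Lemma functional_bound (L : {poly C} -> C) lam r :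
  (forall c p q, L (c *: p + q) = c * L p + L q) ->
  (forall p, L (('X - lam%:P) ^+ r * p) = 0) ->
  exists2 B : C, 0 <= B &
    forall p M, (forall w, `|w - lam| = 1 -> `|p.[w]| <= M) -> `|L p| <= B * M.
Proof.
elim: r L => [|r IH] L Llin Lkill.
  exists 0 => // p M _; rewrite -[p]mul1r -[1]/(('X - lam%:P) ^+ 0) Lkill.
  by rewrite normr0 mul0r.
pose L' p := L (('X - lam%:P) * p).
have [||B B0 HB] := IH L'.
- by move=> c p q; rewrite /L' mulrDr -scalerAr Llin.
- by move=> p; rewrite /L' mulrA -exprS Lkill.
exists (`|L 1| + B * 2%:R) => [|p M H]; first by rewrite addr_ge0 ?mulr_ge0.
have pl := norm_center_le H.
pose p1 := (p - p.[lam]%:P) %/ ('X - lam%:P).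
have p1E : ('X - lam%:P) * p1 = p - p.[lam]%:P.
  by rewrite mulrC divpK // dvdp_XsubCl /root !hornerE subrr.
have -> : L p = p.[lam] * L 1 + L' p1.
  by rewrite /L' p1E -Llin -mul_polyC mulr1 addrC subrK.
apply: le_trans (ler_normD _ _) _; rewrite mulrDl; apply: lerD.
  by rewrite normrM mulrC ler_wpM2l.
rewrite -mulrA; apply: HB => w w1.
have -> : p1.[w] = (p.[w] - p.[lam]) / (w - lam).
  apply: (canRL (mulfK _)); first by rewrite -normr_gt0 w1.
  by have := congr1 (horner^~ w) p1E; rewrite !hornerE mulrC.
rewrite normrM normfV w1 invr1 mulr1 mulr_natl mulr2n.
by apply: le_trans (ler_normB _ _) _; apply: lerD => //; apply: H.
Qed.

End CauchyEstimate.

Import numFieldNormedType.Exports.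

Section Vanishing.
Variable R : realType.
Implicit Types (u v : nat -> R) (c : R).

(** One-sided on purpose: it means that the limit superior is at most 0, so it passes to any smaller
    sequence without a sign condition. *)
Definition vanish u := forall eps, 0 < eps -> exists N, forall n, (N <= n)%N -> u n <= eps.

Lemma vanish_le u v m : (forall n, (m <= n)%N -> u n <= v n) -> vanish v -> vanish u.
Proof.
move=> uv Hv eps /Hv [N HN]; exists (maxn m N) => n; rewrite geq_max => /andP [mn Nn].
exact: le_trans (uv _ mn) (HN _ Nn).
Qed.

Lemma vanish0 : vanish (fun=> 0).
Proof. by move=> eps /ltW e0; exists 0%N. Qed.

Lemma vanishD u v : vanish u -> vanish v -> vanish (fun n => u n + v n).
Proof.
move=> Hu Hv eps e0; have e2 : 0 < eps / 2%:R by rewrite divr_gt0.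
have [N HN] := Hu _ e2; have [M HM] := Hv _ e2.
exists (maxn N M) => n; rewrite geq_max => /andP [Nn Mn].
by have := HN _ Nn; have := HM _ Mn; lra.
Qed.

Lemma vanishZ c u : 0 <= c -> vanish u -> vanish (fun n => c * u n).
Proof.
rewrite le_eqVlt => /predU1P [<- _ | c0 Hu].
  by apply: (@vanish_le _ (fun=> 0) 0) vanish0 => n _; rewrite mul0r.
move=> eps e0; have [|N HN] := Hu (eps / c); first exact: divr_gt0.
by exists N => n /HN; rewrite ler_pdivlMr // mulrC.
Qed.

Lemma vanish_sum k (u : nat -> nat -> R) :
  (forall i, (i < k)%N -> vanish (u i)) -> vanish (fun n => \sum_(i < k) u i n).
Proof.
elim: k => [|k IH] H.
  by apply: (@vanish_le _ (fun=> 0) 0) vanish0 => n _; rewrite big_ord0.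
apply: (@vanish_le _ (fun n => \sum_(i < k) u i n + u k n) 0) => [n _|].
  by rewrite big_ord_recr.
apply: vanishD; last exact: H.
by apply: IH => i ik; apply/H/ltnW.
Qed.

Lemma le_vanish c u m : (forall n, (m <= n)%N -> c <= u n) -> vanish u -> c <= 0.
Proof.
move=> cu Hu; apply/ler_addgt0Pl => eps /Hu [N HN]; rewrite addr0.
by apply: le_trans (cu (maxn m N) (leq_maxl _ _)) (HN _ (leq_maxr _ _)).
Qed.

Lemma vanish_dist u c : (u @ \oo --> c)%classic -> vanish (fun n => `|c - u n|).
Proof.
move=> /cvgrPdist_le uc eps /uc [N _ HN].
by exists N => n Nn; apply: HN.
Qed.

End Vanishing.

(** * Partial sums of the complex exponential *)

Section ComplexExponential.
Variable R : realType.
Local Notation C := R[i].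
Implicit Types (w z : C) (x t : R).

Lemma cabsE w : (cabs w)%:C%C = `|w|.
Proof. by rewrite normc_def. Qed.

Lemma cabs_le w t : (cabs w <= t) = (`|w| <= t%:C%C).
Proof. by rewrite -cabsE lecR. Qed.

Lemma cabs_ge0 w : 0 <= cabs w.
Proof. exact: sqrtr_ge0. Qed.

Lemma cabsD w z : cabs (w + z) <= cabs w + cabs z.
Proof. by rewrite cabs_le rmorphD /= !cabsE ler_normD. Qed.

Lemma cabsM w z : cabs (w * z) = cabs w * cabs z.
Proof. by apply: (@complexI R); rewrite rmorphM /= !cabsE normrM. Qed.

Lemma cabsX w n : cabs (w ^+ n) = cabs w ^+ n.
Proof. by apply: (@complexI R); rewrite rmorphXn /= !cabsE normrX. Qed.

Lemma cabsN w : cabs (- w) = cabs w.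
Proof. by apply: (@complexI R); rewrite !cabsE normrN. Qed.

Lemma cabsB w z : cabs (w - z) = cabs (z - w).
Proof. by rewrite -cabsN opprB. Qed.

Lemma cabs_eq0 w : (cabs w == 0) = (w == 0).
Proof. by rewrite -(inj_eq (@complexI R)) cabsE normr_eq0. Qed.

Lemma cabs0 : cabs (0 : C) = 0.
Proof. by apply/eqP; rewrite cabs_eq0. Qed.

Lemma cabs_sum k (f : 'I_k -> C) : cabs (\sum_i f i) <= \sum_i cabs (f i).
Proof.
elim/big_ind2: _ => [|a b c e H1 H2|i _ //]; first by rewrite cabs0.
exact: le_trans (cabsD _ _) (lerD H1 H2).
Qed.

Lemma expsum_real n x : expsum n (x%:C%C) = (series (exp_coeff x) n)%:C%C.
Proof.
rewrite /series /= big_mkord rmorph_sum; apply: eq_bigr => j _.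
by rewrite rmorphM rmorphXn fmorphV rmorph_nat.
Qed.

Lemma expsum_tail_cabs m n w : (m <= n)%N -> cabs (expsum n w - expsum m w) <=
  series (exp_coeff (cabs w)) n - series (exp_coeff (cabs w)) m.
Proof.
by move=> mn; rewrite cabs_le rmorphB /= -!expsum_real cabsE expsum_tail.
Qed.

Lemma expsum_mul_cabs n w z : cabs (expsum n w * expsum n z - expsum n (w + z)) <=
  series (exp_coeff (cabs w)) n * series (exp_coeff (cabs z)) n -
  series (exp_coeff (cabs w + cabs z)) n.
Proof.
by rewrite cabs_le rmorphB rmorphM /= -!expsum_real rmorphD /= !cabsE expsum_mul.
Qed.

Lemma vanish_expR x : vanish (fun n => `|expR x - series (exp_coeff x) n|).
Proof. exact/vanish_dist/is_cvg_series_exp_coeff. Qed.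

Lemma vanish_cos x : vanish (fun n => `|cos x - series (cos_coeff x) n|).
Proof. by rewrite cos.unlock; apply/vanish_dist/is_cvg_series_cos_coeff. Qed.

Lemma vanish_sin x : vanish (fun n => `|sin x - series (sin_coeff x) n|).
Proof. by rewrite sin.unlock; apply/vanish_dist/is_cvg_series_sin_coeff. Qed.

Lemma series_exp_coeff_le m n x : 0 <= x -> (m <= n)%N ->
  series (exp_coeff x) m <= series (exp_coeff x) n.
Proof.
move=> x0; elim: n => [|n IH]; first by rewrite leqn0 => /eqP ->.
rewrite leq_eqVlt => /predU1P [-> // | /IH H]; apply: le_trans H _.
rewrite /series /= big_nat_recr //= lerDl.
by rewrite /exp_coeff /= divr_ge0 ?exprn_ge0 ?ler0n.
Qed.

Lemma series_exp_coeff_le_expR n x : 0 <= x -> series (exp_coeff x) n <= expR x.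
Proof.
move=> x0; rewrite -subr_le0.
apply: (@le_vanish _ _ (fun m => `|expR x - series (exp_coeff x) m|) n); last exact: vanish_expR.
move=> m /(series_exp_coeff_le x0) nm; rewrite distrC; apply: le_trans (ler_norm _).
by rewrite lerB.
Qed.

Lemma vanish_expR_sub x : 0 <= x -> vanish (fun n => expR x - series (exp_coeff x) n).
Proof.
move=> x0; apply: (@vanish_le _ _ _ 0) (vanish_expR x) => n _.
exact: ler_norm.
Qed.

(** The partial sums at [x] and [t] stay below [expR x] and [expR t], so the difference is at most
    the tail of the series at [x + t]. *)
Lemma vanish_expsum_mul x t : 0 <= x -> 0 <= t -> vanish (fun n =>
  series (exp_coeff x) n * series (exp_coeff t) n - series (exp_coeff (x + t)) n).
Proof.
move=> x0 t0.
apply: (@vanish_le _ _ (fun n => expR (x + t) - series (exp_coeff (x + t)) n) 0).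
  move=> n _; rewrite lerB // expRD ler_pM ?series_exp_coeff_le_expR //.
    by rewrite -[0](_ : series (exp_coeff x) 0 = 0) ?series_exp_coeff_le // /series /= big_nil.
  by rewrite -[0](_ : series (exp_coeff t) 0 = 0) ?series_exp_coeff_le // /series /= big_nil.
exact/vanish_expR_sub/addr_ge0.
Qed.

Lemma expsum_imag n x :
  expsum n (Complex 0 x) = Complex (series (cos_coeff x) n) (series (sin_coeff x) n).
Proof.
elim: n => [|n IH]; first by rewrite expsum0 /series /= !big_nil.
rewrite expsumS IH /series /= !big_nat_recr //= -!/(series _ _).
have iX h : Complex 0 x ^+ h.*2 = ((-1) ^+ h * x ^+ h.*2)%:C%C.
  have i2 : Complex 0 x ^+ 2 = (- x ^+ 2)%:C%C by rewrite !expr2; simpc.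
  by rewrite -mul2n exprM i2 -rmorphXn /= (exprNn (x ^+ 2)) -exprM.
have -> : (n`!%:R : C)^-1 = ((n`!%:R)^-1)%:C%C by rewrite fmorphV rmorph_nat.
suff -> : Complex 0 x ^+ n * ((n`!%:R)^-1)%:C%C = Complex (cos_coeff x n) (sin_coeff x n) by simpc.
rewrite -(odd_double_half n); move: (odd n) (n./2) => [] h; rewrite ?add1n ?add0n.
  rewrite cos_coeff_odd exprS iX /sin_coeff /= odd_double doubleK mul1r; simpc.
  by congr Complex; rewrite exprS; ring.
rewrite sin_coeff_even cos_coeffE iX /= odd_double doubleK mul1r -rmorphM /=.
by congr Complex; ring.
Qed.

(** Since [cexp] is defined by real and imaginary parts, $e^{a+ib}$ is treated as $e^a (\cos b + i
    \sin b)$: convergence of the three real series, plus the multiplication error of [expsum] at $a$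
    and $ib$. *)
Lemma vanish_cexp w : vanish (fun n => cabs (cexp w - expsum n w)).
Proof.
case: w => a b.
have cabs_split x t : cabs (Complex x t) <= `|x| + `|t|.
  rewrite /cabs /= -[X in _ <= X]ger0_norm ?addr_ge0 // -sqrtr_sqr ler_wsqrtr //.
  rewrite -[x ^+ 2]real_normK ?num_real // -[t ^+ 2]real_normK ?num_real //.
  by rewrite sqrrD lerD2r lerDl mulrn_wge0 ?mulr_ge0.
have gen (u v : R) : `|v| <= `|u| + `|u - v|.
  by have := ler_normB u (u - v); rewrite subKr.
have EI : Complex a b = a%:C%C + Complex 0 b by simpc.
pose ea n := series (exp_coeff a) n; pose cb n := series (cos_coeff b) n.
pose sb n := series (sin_coeff b) n.
have Hsplit n : cabs (cexp (Complex a b) - expsum n (Complex a b)) <=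
    (series (exp_coeff (cabs (a%:C%C))) n * series (exp_coeff (cabs (Complex 0 b))) n -
      series (exp_coeff (cabs a%:C%C + cabs (Complex 0 b))) n) +
    (`|expR a| * (`|cos b - cb n| + `|sin b - sb n|) +
     `|expR a - ea n| * (`|cos b| + `|sin b| + (`|cos b - cb n| + `|sin b - sb n|))).
  have -> : cexp (Complex a b) - expsum n (Complex a b) =
     (expsum n a%:C%C * expsum n (Complex 0 b) - expsum n (a%:C%C + Complex 0 b)) +
     ((expR a)%:C%C * Complex (cos b - cb n) (sin b - sb n) +
     (expR a - ea n)%:C%C * Complex (cb n) (sb n)).
    rewrite -EI expsum_real expsum_imag -/(ea n) -/(cb n) -/(sb n).
    rewrite [RHS]addrAC; congr (_ - _).
    by rewrite /cexp /=; simpc; congr Complex; ring.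
  apply: le_trans (cabsD _ _) _; apply: lerD; first exact: expsum_mul_cabs.
  apply: le_trans (cabsD _ _) _; rewrite !cabsM; apply: lerD; apply: ler_pM; rewrite ?cabs_ge0 //.
  - by apply: le_trans (cabs_split _ _) _; rewrite normr0 addr0.
  - by apply: le_trans (cabs_split _ _) _; rewrite normr0 addr0.
  apply: le_trans (cabs_split _ _) _.
  have H1 : `|cb n| <= `|cos b| + `|cos b - cb n|.
    exact: gen.
  have H2 : `|sb n| <= `|sin b| + `|sin b - sb n|.
    exact: gen.
  lra.
apply: (@vanish_le _ _ _ 0 (fun n _ => Hsplit n)).
apply: vanishD; first by apply: vanish_expsum_mul; apply: cabs_ge0.
have Hcs : vanish (fun n => `|cos b - cb n| + `|sin b - sb n|).
  by apply: vanishD; [exact: vanish_cos | exact: vanish_sin].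
apply: vanishD; first by apply: vanishZ => //; apply: normr_ge0.
(* Only boundedness of this factor is needed, so any positive threshold would do. *)
have [|N HN] := Hcs 1; first exact: ltr01.
apply: (@vanish_le _ _ (fun n => (`|cos b| + `|sin b| + 1) * `|expR a - ea n|) N).
  move=> n /HN Hn; rewrite mulrC ler_wpM2r // lerD2l //.
by apply: vanishZ (vanish_expR a); rewrite !addr_ge0.
Qed.

Lemma series_exp_coeff_sub_le m n x t : 0 <= x -> x <= t -> (m <= n)%N ->
  series (exp_coeff x) n - series (exp_coeff x) m <=
  series (exp_coeff t) n - series (exp_coeff t) m.
Proof.
move=> x0 xt; elim: n => [|n IH]; first by rewrite leqn0 => /eqP ->; rewrite !subrr.
rewrite leq_eqVlt => /predU1P [-> | /IH H]; first by rewrite !subrr.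
rewrite /series /= !big_nat_recr //= -!/(series _ _) ![_ + exp_coeff _ _]addrC -!addrA.
apply: lerD => //; rewrite /exp_coeff /= ler_wpM2r ?invr_ge0 ?ler0n //.
by rewrite lerXn2r ?nnegrE // (le_trans x0).
Qed.

(** Compare with a later partial sum, bound the difference by the real tail at [r], and let the
    later index grow. *)
Lemma expsum_uniform n w r : cabs w <= r ->
  cabs (cexp w - expsum n w) <= expR r - series (exp_coeff r) n.
Proof.
move=> wr; rewrite -subr_le0.
apply: (@le_vanish _ _ (fun m => cabs (cexp w - expsum m w)) n); last exact: vanish_cexp.
move=> m nm; have w0 := cabs_ge0 w; have r0 := le_trans w0 wr.
have -> : cexp w - expsum n w = (cexp w - expsum m w) + (expsum m w - expsum n w).
  by rewrite addrA subrK.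
have H1 := cabsD (cexp w - expsum m w) (expsum m w - expsum n w).
have H2 := expsum_tail_cabs w nm.
have H3 := series_exp_coeff_sub_le w0 wr nm.
have H4 := series_exp_coeff_le_expR m r0.
lra.
Qed.

Lemma cexp_neq0 w : cexp w != 0.
Proof.
rewrite -cabs_eq0 /cabs /cexp /= !exprMn -mulrDr cos2Dsin2 mulr1 sqrtr_sqr normr_eq0.
by rewrite gt_eqF ?expR_gt0.
Qed.

End ComplexExponential.

(** * The closure of V in terms of functionals *)

Section Closure.
Variable R : realType.
Local Notation C := R[i].
Implicit Types (p q : {poly C}) (w z x : C).

Lemma poly_bounded q (r : R) : exists2 M : R, 0 <= M &
  forall w, cabs w <= r -> cabs q.[w] <= M.
Proof.
exists (\sum_(j < size q) cabs q`_j * `|r| ^+ j) => [|w wr].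
  by apply: sumr_ge0 => j _; rewrite mulr_ge0 ?cabs_ge0 ?exprn_ge0.
rewrite horner_coef; apply: le_trans (cabs_sum _) _; apply: ler_sum => j _.
rewrite cabsM cabsX ler_wpM2l ?cabs_ge0 // lerXn2r ?nnegrE ?cabs_ge0 //.
exact: le_trans wr (ler_norm _).
Qed.

Variables (V : {poly C} -> Prop) (k : nat) (D : dual_data V k).

Lemma fnl_bounded i : exists2 B : R, 0 <= B & forall p (M : R),
  (forall w, cabs (w - node D i) = 1 -> cabs p.[w] <= M) -> cabs (fnl D i p) <= B * M.
Proof.
have [[a b]] := @functional_bound C (fnl D i) (node D i) (mult D i)
  (@fnl_linear _ _ _ D i) (@fnl_kill _ _ _ D i).
rewrite lecE /= => /andP [/eqP -> a0] H; exists a => // p M HM.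
rewrite cabs_le rmorphM /=; apply: H => w w1; rewrite -cabs_le; apply: HM.
by apply: (@complexI R); rewrite cabsE w1.
Qed.

Definition exp_approx n x q := (exppoly C n \Po (x *: 'X)) * q.

Lemma horner_exp_approx n x q w : (exp_approx n x q).[w] = expsum n (x * w) * q.[w].
Proof. by rewrite hornerM horner_comp horner_exppoly hornerZ hornerX. Qed.

Lemma fnl_exppoly i n x q : (mult D i <= n)%N ->
  fnl D i ((exppoly C n \Po (x *: ('X - (node D i)%:P))) * q) = fnl D i (texp D i x * q).
Proof.
move=> le_n; rewrite exppoly_comp /texp !mulr_suml !fnl_sum.
rewrite [RHS](big_ord_widen n (fun j => fnl D i ((x ^+ j / j`!%:R) *: ('X - (node D i)%:P) ^+ j * q))) //.
rewrite [RHS]big_mkcond; apply: eq_bigr => j _; case: ltnP => // le_j.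
by rewrite -scalerAl fnlZ fnl_kill_ge // mulr0.
Qed.

(** $L_i(e^{xz} q) = e^{x\lambda} L_i(e^{x(z-\lambda)} q)$ at the level of partial sums. For large
    [n] truncating at order [n] or at order [mult D i] makes no difference to $L_i$; the remaining
    multiplication error is bounded on the unit circle around the node. *)
Lemma vanish_fnl_exp i x q : vanish (fun n => cabs
  (fnl D i (exp_approx n x q) - expsum n (x * node D i) * fnl D i (texp D i x * q))).
Proof.
have [B B0 HB] := fnl_bounded i; set lam := node D i in HB *.
have [M M0 HM] := poly_bounded q (cabs lam + 1).
pose del n := series (exp_coeff (cabs (x * lam))) n * series (exp_coeff (cabs x)) n -
  series (exp_coeff (cabs (x * lam) + cabs x)) n.
apply: (@vanish_le _ _ (fun n => B * M * del n) (mult D i)); last first.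
  by apply: vanishZ; rewrite ?mulr_ge0 //; apply: vanish_expsum_mul; apply: cabs_ge0.
move=> n le_n; rewrite -(fnl_exppoly x q le_n) -/lam -fnlZ.
have -> : forall p1 p2, fnl D i p1 - fnl D i p2 = fnl D i (p1 + (-1) *: p2).
  by move=> p1 p2; rewrite fnlD fnlZ mulN1r.
rewrite -mulrA; apply: HB => w w1.
rewrite hornerD hornerZ mulN1r horner_exp_approx hornerZ hornerM horner_comp horner_exppoly.
rewrite hornerZ hornerXsubC mulrA -mulrBl cabsM mulrC.
have ww : cabs w <= cabs lam + 1.
  by rewrite -[w](subrK lam) addrC -w1; apply: cabsD.
apply: ler_pM; rewrite ?cabs_ge0 ?HM //.
have -> : x * w = x * lam + x * (w - lam) by rewrite -mulrDr addrC subrK.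
rewrite cabsB; apply: le_trans (expsum_mul_cabs _ _ _) _.
by rewrite [cabs (x * (w - lam))]cabsM w1 mulr1.
Qed.

Lemma exp_approx_uniform n x q w (r M : R) : cabs w <= r -> cabs q.[w] <= M ->
  cabs (cexp (x * w) * q.[w] - (exp_approx n x q).[w]) <=
  M * (expR (cabs x * r) - series (exp_coeff (cabs x * r)) n).
Proof.
move=> wr qM; rewrite horner_exp_approx -mulrBl cabsM mulrC.
apply: ler_pM; rewrite ?cabs_ge0 //; apply: expsum_uniform.
by rewrite cabsM ler_wpM2l ?cabs_ge0.
Qed.

(** From left to right, each functional is bounded on a circle, hence continuous. Conversely, the
    truncations of $e^{xz} q$ are corrected into [V] by the dual vectors, and the corrections tend
    to 0. *)
Lemma in_closureP x q : in_closure V (fun w => cexp (x * w) * q.[w]) <->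
  forall i, (i < k)%N -> fnl D i (texp D i x * q) = 0.
Proof.
split=> [Hcl i ik | H0 r eps eps0].
  have [B B0 HB] := fnl_bounded i; set lam := node D i in HB *.
  pose r := cabs lam + 1.
  have r0 : 0 <= r by rewrite addr_ge0 ?cabs_ge0.
  have [M M0 HM] := poly_bounded q r; set y := fnl D i _.
  have y0 : cabs (cexp (x * lam) * y) <= 0.
    apply/ler_addgt0Pl => eps eps0; rewrite addr0.
    (* [B + 1] instead of [B], which may be 0. *)
    have e1 : 0 < eps / (B + 1) by rewrite divr_gt0 // ltr_wpDl.
    have [v [Vv Hv]] := Hcl r _ e1.
    pose tau n := expR (cabs x * r) - series (exp_coeff (cabs x * r)) n.
    rewrite -subr_le0; apply: (@le_vanish _ _ (fun n => cabs y * cabs (cexp (x * lam) - expsum n (x * lam)) +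
      (cabs (fnl D i (exp_approx n x q) - expsum n (x * lam) * y) + B * M * tau n)) 0); last first.
      apply: vanishD; first by apply: vanishZ (vanish_cexp _); apply: cabs_ge0.
      apply: vanishD; first exact: vanish_fnl_exp.
      by apply: vanishZ; rewrite ?mulr_ge0 //; apply: vanish_expR_sub; rewrite mulr_ge0 ?cabs_ge0.
    move=> n _.
    have bP : cabs (fnl D i (exp_approx n x q)) <= B * (M * tau n + eps / (B + 1)).
      have -> : fnl D i (exp_approx n x q) = fnl D i (exp_approx n x q + (-1) *: v).
        by rewrite fnlD fnlZ; move/(fnl_mem D): Vv => -> //; rewrite mulr0 addr0.
      apply: HB => w w1; have wr : cabs w <= r.
        by rewrite -[w](subrK lam) addrC /r -w1; apply: cabsD.
      rewrite hornerD hornerZ mulN1r.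
      have -> : (exp_approx n x q).[w] - v.[w] =
         - (cexp (x * w) * q.[w] - (exp_approx n x q).[w]) + (cexp (x * w) * q.[w] - v.[w]).
        by rewrite opprB addrA subrK.
      apply: le_trans (cabsD _ _) _; rewrite cabsN; apply: lerD; last exact/ltW/Hv.
      by apply: exp_approx_uniform => //; apply: HM.
    have Be : B * (eps / (B + 1)) <= eps.
      rewrite mulrCA ger_pMr // ler_pdivrMr ?mul1r ?ltr_wpDl //.
      by rewrite lerDl.
    have -> : cexp (x * lam) * y = (cexp (x * lam) - expsum n (x * lam)) * y +
       (- (fnl D i (exp_approx n x q) - expsum n (x * lam) * y) + fnl D i (exp_approx n x q)).
      by rewrite opprB subrK mulrBl subrK.
    have := cabsD ((cexp (x * lam) - expsum n (x * lam)) * y)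
       (- (fnl D i (exp_approx n x q) - expsum n (x * lam) * y) + fnl D i (exp_approx n x q)).
    have := cabsD (- (fnl D i (exp_approx n x q) - expsum n (x * lam) * y)) (fnl D i (exp_approx n x q)).
    rewrite cabsN cabsM [cabs (_ - expsum _ _) * _]mulrC.
    move: bP; rewrite mulrDr mulrA; lra.
  apply/eqP; move: y0; rewrite le_eqVlt ltNge cabs_ge0 orbF cabs_eq0 mulf_eq0.
  by rewrite (negbTE (cexp_neq0 _)).
have [M M0 HM] := poly_bounded q r.
have Ms i : exists m : R, 0 <= m /\ forall w, cabs w <= r -> cabs (dvec D i).[w] <= m.
  by have [m m0 Hm] := poly_bounded (dvec D i) r; exists m.
have [Mi HMi] := choice Ms.
pose c n i := fnl D i (exp_approx n x q).
(* Subtracting the dual components kills every functional, so [v n] lies in [V]. *)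
pose v n := exp_approx n x q + (-1) *: \sum_(i < k) c n i *: dvec D i.
have Vv n : V (v n).
  apply/(fnl_mem D) => i ik; rewrite fnlD fnlZ fnl_sum (bigD1 (Ordinal ik)) //=.
  rewrite fnlZ fnl_dual // eqxx mulr1 big1 => [|j].
    by rewrite addr0 mulN1r subrr.
  by rewrite -val_eqE /= eq_sym => ji; rewrite fnlZ fnl_dual // (negbTE ji) mulr0.
have r'0 : 0 <= `|r| by [].
have Hvan : vanish (fun n => M * (expR (cabs x * `|r|) - series (exp_coeff (cabs x * `|r|)) n) +
    \sum_(i < k) Mi i * cabs (c n i)).
  apply: vanishD.
    by apply: vanishZ => //; apply: vanish_expR_sub; rewrite mulr_ge0 ?cabs_ge0.
  apply: (@vanish_sum _ k (fun i n => Mi i * cabs (c n i))) => i ik.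
  apply: vanishZ; first by case: (HMi i).
  apply: (@vanish_le _ _ _ 0) (vanish_fnl_exp i x q) => n _.
  by rewrite H0 // mulr0 subr0.
have e2 : 0 < eps / 2%:R by rewrite divr_gt0.
have [N HN] := Hvan _ e2; exists (v N); split=> // w wr.
apply: (@le_lt_trans _ _ (eps / 2%:R)); last lra.
apply: le_trans (HN N (leqnn N)).
rewrite /v hornerD hornerZ mulN1r opprB addrCA.
rewrite addrC; apply: le_trans (cabsD _ _) _; apply: lerD.
  apply: exp_approx_uniform; last exact: HM.
  exact: le_trans wr (ler_norm _).
rewrite horner_sum; apply: le_trans (cabs_sum _) _; apply: ler_sum => i _.
rewrite hornerZ cabsM mulrC; apply: ler_pM; rewrite ?cabs_ge0 //.
by case: (HMi i) => _; apply.
Qed.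

End Closure.

(** * The stationary Baker function *)

Section BakerFunction.
Variable R : realType.
Local Notation C := R[i].
Local Notation tofrac := (@FracField.tofrac {poly C}).
Implicit Types (p q : {poly C}) (x z : C) (G : {poly {poly C}}).

Lemma horner_eval_x x z G : (eval_x x G).[z] = G.[z%:P].[x].
Proof.
have {1}-> : z = horner_eval x z%:P by rewrite /horner_eval hornerC.
by rewrite /eval_x horner_map.
Qed.

Lemma horner_eval_x_swapXY x z G : (eval_x x (swapXY G)).[z] = (eval_x z G).[x].
Proof. by rewrite !horner_eval_x; apply: horner2_swapXY. Qed.

Lemma poly_eq0_everywhere p : (forall x, p.[x] = 0) -> p = 0.
Proof.
move=> p0; apply/eqP/negPn/negP => pN0.
have /(max_poly_roots pN0) : all (root p) [seq i%:R | i <- iota 0 (size p)].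
  by apply/allP => x _; apply/rootP.
rewrite map_inj_uniq ?iota_uniq => [/(_ isT)|i j /eqP]; last by rewrite eqr_nat => /eqP.
by rewrite size_map size_iota ltnn.
Qed.

Lemma poly2_eq0 G : (forall x z, (eval_x x G).[z] = 0) -> G = 0.
Proof.
move=> G0; apply/polyP=> i; rewrite coef0; apply: poly_eq0_everywhere => x.
have -> : (G`_i).[x] = (eval_x x G)`_i by rewrite coef_map.
by rewrite (poly_eq0_everywhere (G0 x)) coef0.
Qed.

Lemma size_monic_sub n p q : (size p <= n.+1)%N -> (size q <= n.+1)%N -> p`_n = q`_n ->
  (size (p - q)%R <= n)%N.
Proof.
move=> sp sq E; apply/leq_sizeP => j; rewrite leq_eqVlt => /predU1P [<- | nj].
  by rewrite coefB E subrr.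
by rewrite coefB !nth_default ?subrr // (leq_trans _ nj).
Qed.

Variable d : pdata R.
Local Notation k := (\sum_(t <- d) t.2)%N.
Variable D : dual_data (Vof d) k.
Variable Q : {poly {poly C}}.
Hypotheses (sQ : size Q = k.+1) (MQ : annih k (moment D) Q).

Let m := mV d.
Let m0 : m != 0. Proof. exact/monic_neq0/mV_monic. Qed.
Lemma in_gammaWP x f : in_gammaW d x f <->
  exists q, annih k (fun i a => (moment D i a).[x]) q /\ f = tofrac q / tofrac m.
Proof.
split=> [[q [/(in_closureP D) H ->]] | [q [H ->]]]; exists q; split=> //.
  by move=> i ik; rewrite pairing_moment_at H.
by apply/(in_closureP D) => i ik; rewrite -pairing_moment_at; apply: H.
Qed.

Variable x : C.
Hypothesis lQx : (lead_coef Q).[x] != 0.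
Hypothesis detx : (\det (\matrix_(a < k, i < k) moment D i a)).[x] != 0.

Let qx := ((lead_coef Q).[x])^-1 *: eval_x x Q.

Let Mqx : annih k (fun i a => (moment D i a).[x]) qx.
Proof. by apply: annihZ => i ik; rewrite -pairing_horner MQ // horner0. Qed.

Let small q : annih k (fun i a => (moment D i a).[x]) q -> (size q <= k)%N -> q = 0.
Proof.
apply: annih_det_eq0; move: detx.
have -> : \matrix_(a < k, i < k) (moment D i a).[x] =
    map_mx (horner_eval x) (\matrix_(a < k, i < k) moment D i a).
  by apply/matrixP=> a i; rewrite !mxE.
by rewrite det_map_mx.
Qed.

Let sub_small : (size (qx - m)%R <= k)%N.
Proof.
apply: size_monic_sub; rewrite ?size_mV //.
  by rewrite (leq_trans (size_scale_leq _ _)) // -sQ size_poly.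
have -> : m`_k = 1.
  by have /monicP := mV_monic d; rewrite lead_coefE size_mV.
rewrite coefZ coef_map /= /horner_eval.
have -> : Q`_k = lead_coef Q by rewrite lead_coefE sQ.
by rewrite mulVf.
Qed.

(** [qx] is monic of the same degree [k] as [m], which gives $1 + O(z^{-1})$. A second candidate
    differs from it by a solution of size at most [k], which vanishes by the determinant condition
    at [x]. *)
Lemma psit_quotient : psit d x (tofrac qx / tofrac m).
Proof.
split.
- by apply/in_gammaWP; exists qx.
- exists qx, m; split=> //; rewrite size_mV ltnS; exact: sub_small.
move=> h' /in_gammaWP [q [Mq ->]] [n [dd [dd0 E lt_n]]].
have {}E : q * dd = n * m by apply/(eq_frac (@tofrac_inj _) _ _ m0 dd0).
have sqm : (size (q - m)%R <= k)%N.
  have [-> | qm0] := eqVneq (q - m) 0; first by rewrite size_poly0.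
  have Em : (q - m) * dd = (n - dd) * m by rewrite !mulrBl E [m * _]mulrC.
  have nd0 : n - dd != 0.
    apply: contra_neq qm0 => nd0; move/eqP: Em; rewrite nd0 mul0r mulf_eq0 (negbTE dd0) orbF.
    by move/eqP.
  have := congr1 (fun p : {poly C} => size p) Em; rewrite !size_mul // size_mV addnS /= => Es.
  move: Es lt_n; case: (size dd) => // t; rewrite addnS /= ltnS => Es ut.
  by rewrite -(leq_add2r t) Es addnC leq_add2l.
have -> : q = qx; last by [].
apply/eqP; rewrite -subr_eq0; apply/eqP/small.
  have -> : q - qx = q + (-1) *: qx by rewrite scaleN1r.
  by apply: annihD => //; apply: annihZ.
have -> : q - qx = (q - m) - (qx - m) by rewrite opprB addrA subrK.
by rewrite (leq_trans (size_polyD _ _)) // size_polyN geq_max sqm sub_small.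
Qed.

Lemma baker_quotient z : m.[z] != 0 ->
  baker d x z (cexp (x * z) * ((eval_x x Q).[z] / ((lead_coef Q).[x] * m.[z]))).
Proof.
move=> mz; exists (tofrac qx / tofrac m); split; first exact: psit_quotient.
exists (qx.[z] / m.[z]); split; first by exists qx, m.
by rewrite hornerZ; congr (_ * _); field; rewrite lQx mz.
Qed.

End BakerFunction.

(** * From equal Baker functions to a polynomial identity *)

Section Bispectrality.
Variable R : realType.
Local Notation C := R[i].
Variables (d d' : pdata R).
Hypothesis dual_dd' : bispectral_dual d d'.
Local Notation k := (\sum_(t <- d) t.2)%N.
Local Notation k' := (\sum_(t <- d') t.2)%N.
Variables (D : dual_data (Vof d) k) (D' : dual_data (Vof d') k').
Variables (Q Q' : {poly {poly C}}).
Hypotheses (sQ : size Q = k.+1) (MQ : annih k (moment D) Q).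
Hypotheses (sQ' : size Q' = k'.+1) (MQ' : annih k' (moment D') Q').
Hypothesis det0 : \det (\matrix_(a < k, i < k) moment D i a) != 0.
Hypothesis det'0 : \det (\matrix_(a < k', i < k') moment D' i a) != 0.

Lemma bispectral_identity : Q' * map_poly polyC (lead_coef Q) * (mV d)%:P =
  swapXY Q * (lead_coef Q')%:P * map_poly polyC (mV d').
Proof.
set l := lead_coef Q; set l' := lead_coef Q'; set m := mV d; set m' := mV d'.
have l0 : l != 0 by rewrite lead_coef_eq0 -size_poly_gt0 sQ.
have l'0 : l' != 0 by rewrite lead_coef_eq0 -size_poly_gt0 sQ'.
have m0 : m != 0 by apply/monic_neq0/mV_monic.
have m'0 : m' != 0 by apply/monic_neq0/mV_monic.
pose dt := \det (\matrix_(a < k, i < k) moment D i a).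
pose dt' := \det (\matrix_(a < k', i < k') moment D' i a).
apply/eqP; rewrite -subr_eq0; set G := _ - _.
(* [A] at [x] and [B] at [z] collect the conditions under which both Baker functions are known at
   the swapped arguments. Multiplying the difference by them gives a polynomial that vanishes
   everywhere. *)
pose A := l' * dt' * m; pose B := l * dt * m'.
have A0 : A%:P != 0 :> {poly {poly C}} by rewrite polyC_eq0 !mulf_neq0.
have B0 : map_poly polyC B != 0.
  by rewrite -swapXY_polyC -(can_eq swapXYK) swapXYK rmorph0 polyC_eq0 !mulf_neq0.
have evC x z (p : {poly C}) : (eval_x x p%:P).[z] = p.[x].
  by rewrite horner_eval_x hornerC.
have evP x z (p : {poly C}) : (eval_x x (map_poly polyC p)).[z] = p.[z].
  by rewrite -swapXY_polyC horner_eval_x_swapXY evC.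
have evM x z (G1 G2 : {poly {poly C}}) :
  (eval_x x (G1 * G2)).[z] = (eval_x x G1).[z] * (eval_x x G2).[z].
  by rewrite !horner_eval_x !hornerM.
have evB x z (G1 G2 : {poly {poly C}}) :
  (eval_x x (G1 - G2)).[z] = (eval_x x G1).[z] - (eval_x x G2).[z].
  by rewrite !horner_eval_x !(hornerD, hornerN).
suff : G * (A%:P * map_poly polyC B) = 0.
  by move/eqP; rewrite !mulf_eq0 (negbTE A0) (negbTE B0) !orbF.
apply: poly2_eq0 => x z; rewrite !evM evC evP.
have [-> | Ax] := eqVneq A.[x] 0; first by rewrite mul0r mulr0.
have [-> | Bz] := eqVneq B.[z] 0; first by rewrite !mulr0.
suff -> : (eval_x x G).[z] = 0 by rewrite mul0r.
move: Ax Bz; rewrite /A /B !hornerM !mulf_eq0 !negb_or.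
move=> /andP [/andP [l'x dt'x] mx] /andP [/andP [lz dtz] m'z].
have := dual_dd' (baker_quotient sQ' MQ' l'x dt'x m'z) (baker_quotient sQ MQ lz dtz mx).
rewrite [z * x]mulrC => /(mulfI (cexp_neq0 _)) E.
rewrite evB !evM evC !evP evC horner_eval_x_swapXY.
have nz1 : l'.[x] * m'.[z] != 0 by rewrite mulf_neq0.
have nz2 : l.[z] * m.[x] != 0 by rewrite mulf_neq0.
move/eqP: E; rewrite eqr_div // => /eqP E.
by apply/eqP; rewrite subr_eq0; apply/eqP; rewrite -!mulrA E.
Qed.

End Bispectrality.

(** The truncation bounds in [bA] cover all coefficients of [a]. *)
Lemma bA_swapXY (R : realType) (a : weyl R) : bA a = swapXY a.
Proof.
apply/polyP=> i; apply/polyP=> j; rewrite coef_swapXY coef_poly.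
case: ltnP => [_|le_i]; first by rewrite coef_poly; case: ltnP => // le_j; rewrite (nth_default 0 le_j) coef0.
rewrite coef0 nth_default //; case: (ltnP j (size a)) => [lt_j|le_j]; last first.
  by rewrite (nth_default 0 le_j) size_poly0.
exact: leq_trans (leq_bigmax (Ordinal lt_j)) le_i.
Qed.

(* For W in Gr^ad (given by a primary decomposition d) and W' = b(W)
   (given by d'), R_{W'} is isomorphic as a right A_1-module to b(L_W).
   The right module b(L_W) is transported along b to L_W, where a in A_1
   acts by D |-> b(a) D; so an isomorphism R_{W'} ~ b(L_W) is a bijection
   phi : R_{W'} -> L_W, additive, with phi (D a) = b(a) phi(D). *)
Theorem theorem1p4 (R : realType) (d d' : pdata R) :
  valid_pdata d -> valid_pdata d' -> bispectral_dual d d' ->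
  exists phi : {poly ratfun R} -> {poly ratfun R},
    [/\ forall D, RW d' D -> LW d (phi D),
        forall D1 D2, RW d' D1 -> RW d' D2 -> phi D1 = phi D2 -> D1 = D2,
        forall E, LW d E -> exists2 D, RW d' D & phi D = E,
        forall D1 D2, RW d' D1 -> RW d' D2 -> phi (D1 + D2) = phi D1 + phi D2 &
        forall D (a : weyl R), RW d' D ->
          phi (opmul D (embA a)) = opmul (embA (bA a)) (phi D)].
Proof.
move=> valid_d valid_d' dual_dd'.
have [D _] := pdata_dual_data valid_d; have [D' _] := pdata_dual_data valid_d'.
have e_inj := @tofrac_inj R[i]; have e_frac := @frac_exists R[i].
pose e : {rmorphism {poly R[i]} -> ratfun R} := @FracField.tofrac {poly R[i]}.
have d_frac := @derivF_frac R[i].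
have derD := @quotient_rule_add _ _ e _ e_inj e_frac d_frac.
have derM := @quotient_rule_mul _ _ e _ e_inj e_frac d_frac.
have d_e := @quotient_rule_e _ _ e _ d_frac.
have [Q [sQ MQ]] := exists_baker_poly derD derM d_e e_inj e_frac D.
have [Q' [sQ' MQ']] := exists_baker_poly derD derM d_e e_inj e_frac D'.
have det0 := det_moment_neq0 derD derM d_e e_inj e_frac D.
have det'0 := det_moment_neq0 derD derM d_e e_inj e_frac D'.
have m0 := monic_neq0 (mV_monic d); have m'0 := monic_neq0 (mV_monic d').
have id := bispectral_identity dual_dd' sQ MQ sQ' MQ' det0 det'0.
have [phi [H1 H2 H3 H4 H5]] :=
  bispectral_isomorphism derD derM d_e e_inj e_frac m0 m'0 sQ MQ sQ' MQ' id.
(* [RW], [LW] and [derivK] are convertible to [RK], [LK] and [derivF]; only the module law needs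
   rewriting. *)
exists phi; split=> // E a RE.
rewrite /opmul !(tw_opmul derD derM) /embA bA_swapXY.
exact: H5.
Qed.
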